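(* Consider the following setting. Let $p$ be a target density on $\mathbb{R}^d$ with score $s_p=\nabla\log p$, and $k$ a continuous positive semi-definite kernel on $\mathbb{R}^d$. Let $q(z)$ be a mixing distribution on $\mathbb{R}^{d_z}$ and $q_\phi(x|z)=\mathcal{N}(\mu(z;\phi),\mathrm{diag}\{\sigma^2(z;\phi)\})$ with $\mu(z;\phi),\sigma(z;\phi)\in\mathbb{R}^d$, i.e. $x=\mu(z;\phi)+\sigma(z;\phi)\odot\xi$ with $\xi\sim\mathcal{N}(0,I_d)$, and $q_\phi(x)=\int q_\phi(x|z)q(z)\mathrm{d}z$. Define $$\mathcal{L}(\phi)=\mathbb{E}\Big[k(x,x')\big(s_p(x)+\xi/\sigma(z;\phi)\big)^\top\big(s_p(x')+\xi'/\sigma(z';\phi)\big)\Big],$$ where $(z,\xi),(z',\xi')$ are i.i.d. copies, $x=\mu(z;\phi)+\sigma(z;\phi)\odot\xi$, $x'=\mu(z';\phi)+\sigma(z';\phi)\odot\xi'$ (this equals $\mathrm{KSD}(q_\phi\|p)^2$). Assume: (A1) there is $B$ with $\max\{k,\|\nabla_1k\|,\|\nabla_{11}k\|,\|\nabla_{12}k\|\}\le B^2$ everywhere; (A2) $\log p$ is three times continuously differentiable with $\|\nabla^2\log p(x)\|\le L$, $\|\nabla^3\log p(x)\|\le M$ for all $x$; (A3) there is $G\ge1$ with $\max\{\|\nabla_\phi\mu(z;\phi)\|,\|\nabla_\phi^2\mu(z;\phi)\|\}\le G(1+\|z\|)$ and the same for $\sigma(z;\phi)$, and every entry of $\sigma(z;\phi)$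 is at least $1/\sqrt{L}$ for all $z,\phi$; (A4) $\mathbb{E}_{q(z)}\|z\|^4\lesssim d_z^2$ and $\mathbb{E}_{q_\phi(x)}\|x\|^4\le s^4$ for all $\phi$. Let $C$ be such that $C^2:=c_0\big[L^4(s^4+\|x^*\|^4)+\|s_p(x^* )\|^4\big]$ for some reference point $x^*\in\mathbb{R}^d$ and absolute constant $c_0$ (so that $\mathbb{E}_{q_\phi}\|s_p(x)\|^4\le C^2$). Then $\mathcal{L}$ is $L_\phi$-smooth (its gradient is $L_\phi$-Lipschitz in $\phi$), where $$L_\phi\lesssim B^2G^2d_z\log d\,\big[(1\vee L)^3+Ld+M^2+C\big].$$
   Context: $\nabla_1k,\nabla_2k$ denote gradients of $k$ w.r.t. its first/second argument, $\nabla_{11}k,\nabla_{12}k$ the corresponding second derivatives. $\odot$ and $\xi/\sigma$ are entrywise product and division. $\|\cdot\|$ is the Euclidean norm for vectors and the operator norm for matrices/tensors. $a\vee b=\max\{a,b\}$. $A\lesssim B$ means $A\le cB$ for an absolute constant $c$.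
   Formalization: The formal theorem assumes d ≥ 2 and d_z ≥ 1: for d = 1 the factor log d (and for d_z = 0 the factor d_z) makes the stated bound 0, which fails e.g. for a one-dimensional Gaussian target with μ = sin φ, σ = 1. *)

(* Defs.v *)
From HB Require Import structures.
From mathcomp Require Import all_boot all_order all_algebra.
From mathcomp Require Import all_classical all_reals all_analysis.
Set Implicit Arguments. Unset Strict Implicit. Unset Printing Implicit Defensive.
Import Order.TTheory GRing.Theory Num.Theory.
Import numFieldNormedType.Exports.
Local Open Scope classical_set_scope.
Local Open Scope ring_scope.

Section Defs.
Context {R : realType}.

Definition evec n (i : 'I_n) : 'rV[R]_n := delta_mx 0 i.
Definition dotv n (u v : 'rV[R]_n) : R := \sum_(i < n) u 0 i * v 0 i.
Definition enorm n (v : 'rV[R]_n) : R := Num.sqrt (dotv v v).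
Definition grad n (f : 'rV[R]_n -> R) (x : 'rV[R]_n) : 'rV[R]_n :=
  \row_i ('D_(evec i) f x).
Definition hadam n (u v : 'rV[R]_n) : 'rV[R]_n := \row_i (u 0 i * v 0 i).
Definition ediv n (u v : 'rV[R]_n) : 'rV[R]_n := \row_i (u 0 i / v 0 i).

Definition C3 n (f : 'rV[R]_n -> R) : Prop :=
  (forall x, differentiable f x) /\
  (forall w x, differentiable ('D_w f) x) /\
  (forall v w x, differentiable ('D_v ('D_w f)) x) /\
  (forall u v w, continuous ('D_u ('D_v ('D_w f)))).

Definition cont_psd_kernel n (k : 'rV[R]_n -> 'rV[R]_n -> R) : Prop :=
  continuous (fun xy : 'rV[R]_n * 'rV[R]_n => k xy.1 xy.2) /\
  (forall x y, k x y = k y x) /\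
  (forall (N : nat) (xs : 'I_N -> 'rV[R]_n) (c : 'I_N -> R),
      0 <= \sum_(i < N) \sum_(j < N) c i * c j * k (xs i) (xs j)).

Definition xsample dz d m (mu sigma : 'rV[R]_dz -> 'rV[R]_m -> 'rV[R]_d)
  (phi : 'rV[R]_m) (z : 'rV[R]_dz) (xi : 'rV[R]_d) : 'rV[R]_d :=
  mu z phi + hadam (sigma z phi) xi.

(* the KSD objective L(phi): expectation over two i.i.d. copies (z,xi),(z',xi'),
   realised as the product P \x P of the underlying probability space *)
Definition ksd_loss dO (Omega : measurableType dO) (P : probability Omega R)
  dz d m (z : Omega -> 'rV[R]_dz) (xi : Omega -> 'rV[R]_d)
  (k : 'rV[R]_d -> 'rV[R]_d -> R) (sp : 'rV[R]_d -> 'rV[R]_d)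
  (mu sigma : 'rV[R]_dz -> 'rV[R]_m -> 'rV[R]_d) (phi : 'rV[R]_m) : R :=
  \int[(P \x P)%E]_(w in [set: Omega * Omega])
    (let x  := xsample mu sigma phi (z w.1) (xi w.1) in
     let x' := xsample mu sigma phi (z w.2) (xi w.2) in
     k x x' * dotv (sp x  + ediv (xi w.1) (sigma (z w.1) phi))
                   (sp x' + ediv (xi w.2) (sigma (z w.2) phi))).

End Defs.

(* Main.v *)
Require Import Defs.
From HB Require Import structures.
From mathcomp Require Import all_boot all_order all_algebra.
From mathcomp Require Import all_classical all_reals all_analysis.
From mathcomp Require Import measurable_realfun ring lra.
Import Order.TTheory GRing.Theory Num.Theory.
Import numFieldNormedType.Exports.
Local Open Scope classical_set_scope.
Local Open Scope ring_scope.

(** Write [h(phi)] for the random integrand [k(x,x') <F,F'>], where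
    [F = s_p(x) + xi/sigma].  Expanding [mu], [sigma], [k] and [s_p] to second
    order gives, for every outcome, a linear form [dh(phi)] with
    [|h(phi+v) - h(phi) - dh(phi) v| <= Lam |v|^2], where [Lam] is quadratic in
    [A = G (1+|z|) (1+max_i |xi_i|)] and at most quadratic in the values of [F]
    at [phi] and [phi+v] only.  By AM-GM the mean of [Lam] is controlled by
    [E A^4] and [E |F|^4].  The first is [O((G^2 dz ln d)^2)], because [z] and
    [xi] are independent and [E exp(xi_i^2/4)] is finite; the second is
    [O((C + L d)^2)], because [s_p] is [L]-Lipschitz.  Finally, a function whose
    linear approximations have a quadratic remainder with a uniform constant [Q]
    is differentiable with a [6Q]-Lipschitz gradient, so that no second
    derivative of the loss is needed. *)

Set Implicit Arguments.
Unset Strict Implicit.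

(** * Euclidean geometry and mean value bounds *)

Section Euclidean.
Context {R : realType}.
Implicit Types (n : nat) (a c : R).

(** The samples have bounded fourth moments at each parameter separately, not for a supremum over
    parameters inside the expectation. A remainder between [phi] and [phi + v] asks for moments at
    these two parameters only. With fourth moments as the only resource, it has to stay quadratic
    both in the speed [A] of the sample and in the noisy scores. The terms linear in [F] carry the
    coefficients [M] (third derivative of log p), [L], and [L * sqrt L] (second order error of
    1/sigma, with three reciprocals of size [sqrt L]). Completing the square in them is the origin
    of [M^2] and of the cube of [max 1 L]. The weight in AM-GM is the ratio of the two scales
    [G^2 dz ln d] and [C + L d], so that the mean is of the order of their product rather than of
    the sum of their squares. Since [d >= 2], [ln d] is at least [ln 2], and this absorbs the
    additive constants of the Gaussian estimate. *)

Lemma dotvC n (u v : 'rV[R]_n) : dotv u v = dotv v u.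
Proof. by apply: eq_bigr => i _; rewrite mulrC. Qed.

Lemma dotvDl n (u v w : 'rV[R]_n) : dotv (u + v) w = dotv u w + dotv v w.
Proof. by rewrite -big_split; apply: eq_bigr => i _; rewrite mxE mulrDl. Qed.

Lemma dotvDr n (u v w : 'rV[R]_n) : dotv w (u + v) = dotv w u + dotv w v.
Proof. by rewrite dotvC dotvDl !(dotvC _ w). Qed.

Lemma dotvZl n a (u v : 'rV[R]_n) : dotv (a *: u) v = a * dotv u v.
Proof. by rewrite mulr_sumr; apply: eq_bigr => i _; rewrite mxE mulrA. Qed.

Lemma dotvZr n a (u v : 'rV[R]_n) : dotv u (a *: v) = a * dotv u v.
Proof. by rewrite dotvC dotvZl dotvC. Qed.

Lemma dotvNl n (u v : 'rV[R]_n) : dotv (- u) v = - dotv u v.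
Proof. by rewrite -scaleN1r dotvZl mulN1r. Qed.

Lemma dotvBl n (u v w : 'rV[R]_n) : dotv (u - v) w = dotv u w - dotv v w.
Proof. by rewrite dotvDl dotvNl. Qed.

Lemma dotvBr n (u v w : 'rV[R]_n) : dotv w (u - v) = dotv w u - dotv w v.
Proof. by rewrite dotvC dotvBl !(dotvC _ w). Qed.

Lemma dotv_ge0 n (u : 'rV[R]_n) : 0 <= dotv u u.
Proof. by apply: sumr_ge0 => i _; rewrite -expr2 sqr_ge0. Qed.

Lemma enorm_ge0 n (u : 'rV[R]_n) : 0 <= enorm u.
Proof. exact: sqrtr_ge0. Qed.

Lemma sqr_enorm n (u : 'rV[R]_n) : enorm u ^+ 2 = dotv u u.
Proof. by rewrite sqr_sqrtr// dotv_ge0. Qed.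

Lemma sqr_coord_le_dotv n (u : 'rV[R]_n) i : u 0 i ^+ 2 <= dotv u u.
Proof.
rewrite /dotv (bigD1 i)//= -expr2 lerDl.
by apply: sumr_ge0 => j _; rewrite -expr2 sqr_ge0.
Qed.

Lemma coord_le_enorm n (u : 'rV[R]_n) i : `|u 0 i| <= enorm u.
Proof. by rewrite -sqrtr_sqr ler_wsqrtr// sqr_coord_le_dotv. Qed.

Lemma enorm_eq0 n (u : 'rV[R]_n) : enorm u = 0 -> u = 0.
Proof.
move=> u0; apply/rowP => i; rewrite mxE; apply/eqP; rewrite -normr_le0 -u0.
exact: coord_le_enorm.
Qed.

Lemma enorm0 n : enorm (0 : 'rV[R]_n) = 0.
Proof. by rewrite /enorm -(scale0r 0) dotvZl mul0r sqrtr0. Qed.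

Lemma dotv_sqr_le n (u v : 'rV[R]_n) : dotv u v ^+ 2 <= dotv u u * dotv v v.
Proof.
have [v0|v0] := eqVneq (dotv v v) 0.
  have -> : v = 0 by apply: enorm_eq0; rewrite /enorm v0 sqrtr0.
  by rewrite -(scale0r 0) !dotvZr !mul0r mulr0 expr0n.
have vp : 0 < dotv v v by rewrite lt_def v0 dotv_ge0.
(* The squared length of this vector is [b * (a * b - c ^+ 2)]: up to a factor it is the component
   of [u] orthogonal to [v]. *)
have := dotv_ge0 (dotv v v *: u - dotv u v *: v).
rewrite dotvBl !dotvBr !dotvZl !dotvZr (dotvC v u).
set a := dotv u u; set b := dotv v v; set c := dotv u v => h.
have : 0 <= b * (a * b - c ^+ 2) by move: h; congr (_ <= _); ring.
by rewrite pmulr_rge0// subr_ge0.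
Qed.

Lemma cauchy_schwarz n (u v : 'rV[R]_n) : `|dotv u v| <= enorm u * enorm v.
Proof.
rewrite -sqrtr_sqr /enorm -sqrtrM ?dotv_ge0// ler_wsqrtr//.
exact: dotv_sqr_le.
Qed.

Lemma dotv_le_enorm n (u v : 'rV[R]_n) : dotv u v <= enorm u * enorm v.
Proof. exact: le_trans (ler_norm _) (cauchy_schwarz _ _). Qed.

Lemma enormZ n a (u : 'rV[R]_n) : enorm (a *: u) = `|a| * enorm u.
Proof.
by rewrite /enorm dotvZl dotvZr mulrA -expr2 sqrtrM ?sqr_ge0// sqrtr_sqr.
Qed.

Lemma enormN n (u : 'rV[R]_n) : enorm (- u) = enorm u.
Proof. by rewrite -scaleN1r enormZ normrN1 mul1r. Qed.

Lemma enormD n (u v : 'rV[R]_n) : enorm (u + v) <= enorm u + enorm v.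
Proof.
rewrite -(@ler_pXn2r _ 2)// ?nnegrE ?addr_ge0 ?enorm_ge0// sqr_enorm.
rewrite dotvDl !dotvDr (dotvC v u) sqrrD !sqr_enorm.
by have := dotv_le_enorm u v; lra.
Qed.

Lemma enormB n (u v : 'rV[R]_n) : enorm (u - v) <= enorm u + enorm v.
Proof. by rewrite -(enormN v) enormD. Qed.

Lemma enorm_dual n (u : 'rV[R]_n) c : 0 <= c ->
  (forall e, dotv u e <= c * enorm e) -> enorm u <= c.
Proof.
move=> c0 /(_ u); rewrite -sqr_enorm expr2.
have [->//|u0] := eqVneq (enorm u) 0.
by rewrite ler_pM2r// lt_def u0 enorm_ge0.
Qed.

Lemma enorm_le_coord n (u v : 'rV[R]_n) c : 0 <= c ->
  (forall i, `|u 0 i| <= c * `|v 0 i|) -> enorm u <= c * enorm v.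
Proof.
move=> c0 uv; rewrite -(ger0_norm c0) -enormZ ler_wsqrtr//.
apply: ler_sum => i _; rewrite -!expr2 -real_normK ?num_real//.
rewrite -[leRHS]real_normK ?num_real// mxE normrM (ger0_norm c0).
by rewrite ler_pXn2r ?nnegrE// mulr_ge0.
Qed.

Lemma coord_le_mx_norm n (v : 'rV[R]_n) i : `|v 0 i| <= `|v|.
Proof.
rewrite [leRHS]/Num.norm/= mx_normrE; apply/bigmax_geP; right => /=.
by exists (0, i).
Qed.

Lemma dotv_le_mx_norm n (v : 'rV[R]_n) : dotv v v <= n%:R * `|v| ^+ 2.
Proof.
have -> : n%:R * `|v| ^+ 2 = \sum_(i < n) `|v| ^+ 2.
  by rewrite sumr_const card_ord mulr_natl.
apply: ler_sum => i _; rewrite -expr2 -real_normK ?num_real//.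
by rewrite ler_pXn2r ?nnegrE// coord_le_mx_norm.
Qed.

End Euclidean.

(** * Directional derivatives, mean value theorem and second order Taylor bounds *)

Section Calculus.
Context {R : realType}.

Lemma rowvec_sum n (v : 'rV[R]_n) : v = \sum_(i < n) v 0 i *: evec i.
Proof.
by rewrite [LHS]matrix_sum_delta big_ord1.
Qed.

Lemma derive_linear (V W : normedModType R) (f : V -> W) x :
  differentiable f x -> linear (fun v => 'D_v f x).
Proof. by move=> df a u v; rewrite !deriveE// linearP. Qed.

Lemma derive_linear_fun (V : normedModType R) (f : V -> R) x a u v :
  differentiable f x -> 'D_(a *: u + v) f x = a * 'D_u f x + 'D_v f x.
Proof. by move=> df; rewrite !deriveE// linearP. Qed.

Lemma is_derive_line (V W : normedModType R) (f : V -> W) x h t :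
  differentiable f (x + t *: h) ->
  is_derive t 1 (fun s => f (x + s *: h)) ('D_h f (x + t *: h)).
Proof.
move=> df.
have E : (fun s : R => s^-1 *: (f (x + (s *: (1 : R) + t) *: h) - f (x + t *: h)))
  = (fun s => s^-1 *: (f (s *: h + (x + t *: h)) - f (x + t *: h))).
  apply/funext => s; congr (_ *: (f _ - _)).
  by rewrite [s *: (1 : R)]mulr1 scalerDl addrCA.
split; last by rewrite /derive /= -E.
by have := diff_derivable (v := h) df; rewrite /derivable /= -E.
Qed.

Lemma mean_value_line n (f : 'rV[R]_n -> R) x h :
  (forall y, differentiable f y) ->
  exists2 c, 0 <= c <= 1 & f (x + h) - f x = 'D_h f (x + c *: h).
Proof.
move=> df.
have [c c01] := @MVT_segment R (fun s => f (x + s *: h))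
  (fun t => 'D_h f (x + t *: h)) 0 1 ler01 (fun t _ => is_derive_line (df _))
  (derivable_within_continuous (fun t _ => @ex_derive _ _ _ _ _ _ _
     (is_derive_line (df _)))).
rewrite scale1r scale0r addr0 subr0 mulr1 => E; by exists c.
Qed.

(** The assumptions bound derivatives in unit directions. Rescaling extends this to all directions,
    one argument at a time for a multilinear form. *)
Lemma homogeneous_bound n (q : 'rV[R]_n -> R) c :
  (forall a u, q (a *: u) = `|a| * q u) ->
  (forall u, enorm u <= 1 -> q u <= c) -> forall u, q u <= c * enorm u.
Proof.
move=> hq qc u; have [/enorm_eq0 ->|u0] := eqVneq (enorm u) 0.
  by rewrite enorm0 mulr0 -(scale0r 0) hq normr0 mul0r.
have := qc ((enorm u)^-1 *: u).
rewrite enormZ hq ger0_norm ?invr_ge0 ?enorm_ge0// mulVf// => /(_ (lexx _)).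
by rewrite mulrC ler_pdivrMr// lt_def u0 enorm_ge0.
Qed.

Lemma derive_scale (V W : normedModType R) (f : V -> W) a u x :
  differentiable f x -> 'D_(a *: u) f x = a *: 'D_u f x.
Proof. by move=> df; rewrite !deriveE// linearZ. Qed.

Lemma derive_funZ (V W : normedModType R) (f : V -> W) a v x :
  differentiable f x -> 'D_v (fun y => a *: f y) x = a *: 'D_v f x.
Proof. by move=> df; apply: (deriveZ a (diff_derivable df)). Qed.

Lemma derive2_scalel (V W : normedModType R) (f : V -> W) a u v x :
  (forall x, differentiable f x) ->
  (forall w x, differentiable ('D_w f) x) ->
  'D_v ('D_(a *: u) f) x = a *: 'D_v ('D_u f) x.
Proof.
move=> df ddf; rewrite -derive_funZ//; congr derive.
by apply/funext => y; rewrite derive_scale.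
Qed.

Lemma derive3_scalel (V W : normedModType R) (f : V -> W) a u v w x :
  (forall x, differentiable f x) ->
  (forall w x, differentiable ('D_w f) x) ->
  (forall v w x, differentiable ('D_v ('D_w f)) x) ->
  'D_u ('D_v ('D_(a *: w) f)) x = a *: 'D_u ('D_v ('D_w f)) x.
Proof.
move=> df ddf dddf; rewrite -[RHS]derive_funZ; last exact: dddf.
congr derive; apply/funext => y; apply: derive2_scalel.
  exact: df.
exact: ddf.
Qed.

Lemma norm_derive_scale (V : normedModType R) (f : V -> R) a u x :
  differentiable f x -> `|'D_(a *: u) f x| = `|a| * `|'D_u f x|.
Proof.
by move=> df; exact: etrans (congr1 _ (derive_scale a u df)) (normrM _ _).
Qed.

Lemma norm_derive2_scalel (V : normedModType R) (f : V -> R) a u v x :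
  (forall x, differentiable f x) ->
  (forall w x, differentiable ('D_w f) x) ->
  `|'D_v ('D_(a *: u) f) x| = `|a| * `|'D_v ('D_u f) x|.
Proof.
move=> df ddf.
exact: etrans (congr1 _ (derive2_scalel a u v x df ddf)) (normrM _ _).
Qed.

Lemma norm_derive3_scalel (V : normedModType R) (f : V -> R) a u v w x :
  (forall x, differentiable f x) ->
  (forall w x, differentiable ('D_w f) x) ->
  (forall v w x, differentiable ('D_v ('D_w f)) x) ->
  `|'D_u ('D_v ('D_(a *: w) f)) x| = `|a| * `|'D_u ('D_v ('D_w f)) x|.
Proof.
move=> df ddf dddf.
exact: etrans (congr1 _ (derive3_scalel a u v w x df ddf dddf)) (normrM _ _).
Qed.

Section Vector_valued.
Variables (m n : nat) (V : 'rV[R]_m -> 'rV[R]_n) (e : 'rV[R]_n).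

Let dotv_sumE : (fun y => dotv (V y) e) =
  \sum_(i < n) (fun y => e 0 i *: V y 0 i).
Proof.
by apply/funext => y; rewrite fct_sumE; apply: eq_bigr => i _; rewrite mulrC.
Qed.

Let differentiable_coord_comp x i : differentiable V x ->
  differentiable (fun y => V y 0 i) x.
Proof.
by move=> dV; apply: differentiable_comp dV (differentiable_coord _ _ _).
Qed.

Lemma differentiable_dotv x : differentiable V x ->
  differentiable (fun y => dotv (V y) e) x.
Proof.
move=> dV; rewrite dotv_sumE; apply: differentiable_sum => i.
exact/differentiableZ/differentiable_coord_comp.
Qed.

Lemma derive_dotv x h : differentiable V x ->
  'D_h (fun y => dotv (V y) e) x = dotv ('D_h V x) e.
Proof.
move=> dV; rewrite dotv_sumE derive_sum; last first.
  by move=> i; exact/diff_derivable/differentiableZ/differentiable_coord_comp.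
apply: eq_bigr => i _; rewrite deriveZ; last first.
  exact/diff_derivable/differentiable_coord_comp.
by rewrite derive_mx ?mxE ?[_ *: _]mulrC//; exact: diff_derivable.
Qed.

End Vector_valued.

Lemma mean_value_bound n (f : 'rV[R]_n -> R) x h c :
  (forall y, differentiable f y) -> (forall y, `|'D_h f y| <= c) ->
  `|f (x + h) - f x| <= c.
Proof. by move=> df fc; have [t _ ->] := mean_value_line x h df. Qed.

(** Two mean value theorems: the increment is ['D_h f] at [x + t *: h], and moving this point back
    to [x] costs [t] times a second derivative. With [t <= 1] the Taylor factor 1/2 is given up. *)
Lemma taylor_bound n (f : 'rV[R]_n -> R) x h c :
  (forall y, differentiable f y) -> (forall y, differentiable ('D_h f) y) ->
  (forall y, `|'D_h ('D_h f) y| <= c) ->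
  `|f (x + h) - f x - 'D_h f x| <= c.
Proof.
move=> df ddf fc; have [t /andP[t0 t1] ->] := mean_value_line x h df.
have [s _ ->] := mean_value_line x (t *: h) ddf.
rewrite derive_scale// normrM ger0_norm//.
by apply: le_trans (fc (x + s *: (t *: h))); rewrite ler_piMl.
Qed.

(** A vector-valued map has no common intermediate point for all coordinates, so each test vector
    [e] gets its own, and [enorm_dual] recovers the norm. *)
Lemma mean_value_bound_vec m n (V : 'rV[R]_m -> 'rV[R]_n) x h c : 0 <= c ->
  (forall y, differentiable V y) -> (forall y, enorm ('D_h V y) <= c) ->
  enorm (V (x + h) - V x) <= c.
Proof.
move=> c0 dV Vc; apply: enorm_dual => // e.
rewrite dotvBl; apply: le_trans (ler_norm _) _.
apply: (@mean_value_bound _ (fun y => dotv (V y) e)) => [y|y].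
  exact: differentiable_dotv.
rewrite derive_dotv//; apply: le_trans (cauchy_schwarz _ _) _.
by rewrite ler_wpM2r ?enorm_ge0.
Qed.

Lemma taylor_bound_vec m n (V : 'rV[R]_m -> 'rV[R]_n) x h c : 0 <= c ->
  (forall y, differentiable V y) -> (forall y, differentiable ('D_h V) y) ->
  (forall y, enorm ('D_h ('D_h V) y) <= c) ->
  enorm (V (x + h) - V x - 'D_h V x) <= c.
Proof.
move=> c0 dV ddV Vc; apply: enorm_dual => // e.
rewrite !dotvBl -derive_dotv//; apply: le_trans (ler_norm _) _.
have E : 'D_h (fun y => dotv (V y) e) = (fun y => dotv ('D_h V y) e).
  by apply/funext => y; rewrite derive_dotv.
apply: (@taylor_bound _ (fun y => dotv (V y) e)) => [y|y|y].
- exact: differentiable_dotv.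
- by rewrite E; exact: differentiable_dotv.
rewrite E derive_dotv//; apply: le_trans (cauchy_schwarz _ _) _.
by rewrite ler_wpM2r ?enorm_ge0.
Qed.

End Calculus.

(** * Quadratic remainders *)

Section Quadratic_remainder.
Context {R : realType}.

(** A named copy of [dotv], to which the linear structure required of a differential can be
    attached. *)
Definition dotv_with n (u v : 'rV[R]_n) : R := dotv u v.

Lemma dotv_with_linear n (u : 'rV[R]_n) : linear (dotv_with u).
Proof. by move=> a v w; rewrite /dotv_with dotvDr dotvZr. Qed.

HB.instance Definition _ n (u : 'rV[R]_n) :=
  GRing.isLinear.Build R 'rV[R]_n R _ (dotv_with u) (dotv_with_linear u).

Lemma dotv_with_continuous n (u : 'rV[R]_n) : continuous (dotv_with u).
Proof.
have E : dotv_with u = \sum_(i < n) (fun v : 'rV[R]_n => u 0 i *: v 0 i).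
  by apply/funext => v; rewrite fct_sumE.
move=> v; apply: differentiable_continuous; rewrite E.
by apply: differentiable_sum => i; exact/differentiableZ/differentiable_coord.
Qed.

Lemma dotv_evec n (u : 'rV[R]_n) i : dotv u (evec i) = u 0 i.
Proof.
rewrite /dotv (bigD1 i)//= big1 => [|j ji]; rewrite mxE eqxx/= ?eqxx ?mulr1 ?addr0//.
by rewrite (negbTE ji) mulr0.
Qed.

Section Gradient.
Variables (n : nat) (f : 'rV[R]_n -> R) (g : 'rV[R]_n -> 'rV[R]_n) (Q : R).
Hypothesis fg : forall x h, `|f (x + h) - f x - dotv (g x) h| <= Q * enorm h ^+ 2.

Let quadratic_littleo (x : 'rV[R]_n) :
  (f : 'rV[R]_n -> R^o) \o shift x
    = cst (f x) + (dotv_with (g x) : _ -> R^o) +o_ (0 : 'rV[R]_n) id.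
Proof.
apply/eqaddoP => _/posnumP[e].
(* The little-o is stated in the sup norm of row vectors, and [n%:R] is the price of passing from
   the Euclidean norm to it. The [+ 1] keeps the denominator positive when [Q] or [n] vanishes. *)
have Q1 : 0 < `|Q| * n%:R + 1 by rewrite ltr_wpDl// mulr_ge0.
have near0 : \forall h \near (0 : 'rV[R]_n), `|h| <= e%:num / (`|Q| * n%:R + 1).
  have := @nbhs0_le R 'rV[R]_n (e%:num / (`|Q| * n%:R + 1)).
  by apply; rewrite divr_gt0.
apply: filterS near0 => h he; 
rewrite /=.
rewrite [X in Num.norm X](_ : _ = f (x + h) - f x - dotv (g x) h); last first.
  by rewrite (addrC x) -addrA -opprD.
apply: le_trans (fg x h) _; rewrite sqr_enorm.
have h2 := dotv_le_mx_norm h.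
apply: (@le_trans _ _ (`|Q| * (n%:R * `|h| ^+ 2))).
  apply: (@le_trans _ _ (`|Q| * dotv h h)); last by rewrite ler_wpM2l.
  by rewrite ler_wpM2r ?dotv_ge0 ?ler_norm.
rewrite expr2 !mulrA ler_wpM2r//.
apply: (@le_trans _ _ ((`|Q| * n%:R + 1) * `|h|)).
  by rewrite ler_wpM2r// lerDl.
by rewrite mulrC -ler_pdivlMr.
Qed.

Let diff_quadratic x : 'd f x = dotv_with (g x) :> (_ -> _).
Proof.
exact: diff_unique (@dotv_with_continuous n (g x)) (quadratic_littleo x).
Qed.

Lemma quadratic_differentiable x : differentiable f x.
Proof.
apply/diff_locallyP; rewrite diff_quadratic; split.
  exact: dotv_with_continuous.
exact: quadratic_littleo.
Qed.

Lemma quadratic_grad x : grad f x = g x.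
Proof.
apply/rowP => i; rewrite mxE deriveE; last exact: quadratic_differentiable.
by rewrite diff_quadratic /dotv_with dotv_evec.
Qed.

(* Comparing the expansions of [f (y + v)] at [x] and at [y], for [v] of the
   size of [y - x], bounds [dotv (g y - g x) v]. *)
Lemma quadratic_lipschitz x y : 0 <= Q ->
  enorm (g x - g y) <= 6 * Q * enorm (x - y).
Proof.
move=> Q0; set r := enorm (x - y).
have r0 : 0 <= r by exact: enorm_ge0.
have [/enorm_eq0/eqP|rN0] := eqVneq r 0.
  rewrite subr_eq0 => /eqP ->.
  by rewrite subrr enorm0 !mulr_ge0 ?enorm_ge0.
have rp : 0 < r by rewrite lt_def rN0.
have key v : enorm v <= 1 -> `|dotv (g x - g y) v| <= 6 * Q * r.
  move=> v1; rewrite -(ler_pM2l rp) -[r in X in X * _ <= _]ger0_norm//.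
  rewrite -normrM -dotvZr; set w := r *: v.
  have wr : enorm w <= r by rewrite enormZ ger0_norm// ler_piMr.
  have yxr : enorm (y - x + w) <= 2 * r.
    have := enormD (y - x) w; rewrite -[enorm (y - x)]enormN opprB -/r; lra.
  have yx : enorm (y - x) = r by rewrite -enormN opprB.
  have sq (u : 'rV[R]_n) (c : R) : enorm u <= c -> Q * enorm u ^+ 2 <= Q * c ^+ 2.
    move=> uc; rewrite ler_wpM2l// ler_pXn2r// nnegrE ?enorm_ge0//.
    exact: le_trans (enorm_ge0 _) uc.
  (* In units of [Q * r ^+ 2], the expansion at [y] with step [w] costs 1, the one at [x] with a
     step of length at most [2 * r] costs 4, and the one at [x] with step [y - x] costs 1. This is
     the 6. *)
  have h1 := le_trans (fg y w) (sq _ _ wr).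
  have h2 := le_trans (fg x (y - x + w)) (sq _ _ yxr).
  have h3 := fg x (y - x); rewrite yx in h3.
  have E : x + (y - x) = y by rewrite addrC subrK.
  rewrite E in h3; rewrite addrA E dotvDr in h2.
  rewrite dotvBl; move: h1 h2 h3; rewrite !ler_norml => h1 h2 h3.
  rewrite exprMn in h2.
  have -> : r * (6 * Q * r) = 6 * (Q * r ^+ 2) by ring.
  have E4 : Q * (2 ^+ 2 * r ^+ 2) = 4 * (Q * r ^+ 2) by ring.
  rewrite E4 in h2; lra.
apply: enorm_dual => [|e]; first by rewrite !mulr_ge0.
apply: le_trans (ler_norm _) _.
apply: (homogeneous_bound (q := fun e => `|dotv (g x - g y) e|)) => // a u.
by rewrite dotvZr normrM.
Qed.

End Gradient.
End Quadratic_remainder.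

(** * Kernel and score *)

Section Kernel.
Context {R : realType}.
Variables (n : nat) (k : 'rV[R]_n -> 'rV[R]_n -> R) (B : R).
Hypothesis k_psd : cont_psd_kernel k.
Hypothesis dk : forall y x, differentiable (k ^~ y) x.
Hypothesis d11k : forall y u x, differentiable ('D_u (k ^~ y)) x.
Hypothesis d12k : forall x u y, differentiable (fun y' => 'D_u (k ^~ y') x) y.
Hypothesis kB : forall x y (u v : 'rV[R]_n), enorm u <= 1 -> enorm v <= 1 ->
     [/\ k x y <= B ^+ 2,
         `|'D_u (k ^~ y) x| <= B ^+ 2,
         `|'D_v ('D_u (k ^~ y)) x| <= B ^+ 2
       & `|'D_v (fun y' => 'D_u (k ^~ y') x) y| <= B ^+ 2].

(** The assumption bounds [k] from above only. The Gram form of [x, y] with coefficients 1 and -1 or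
    1 and 1 is nonnegative, so [2 * |k x y|] is at most [k x x + k y y]. *)
Lemma kernel_bound x y : `|k x y| <= B ^+ 2.
Proof.
have [_ [ksym kpsd]] := k_psd.
have n01 : enorm (0 : 'rV[R]_n) <= 1 by rewrite enorm0.
have [kx _ _ _] := kB x x n01 n01; have [ky _ _ _] := kB y y n01 n01.
have gram c : 0 <= k x x + c * k x y + (c * k y x + c * c * k y y).
  have := kpsd 2 (fun i => if i == 0 then x else y) (fun i => if i == 0 then 1 else c).
  by rewrite !big_ord_recl !big_ord0 /= !addr0 !mul1r mulr1.
have := gram 1; have := gram (-1); rewrite (ksym y x) ler_norml.
by move: kx ky; set b := B ^+ 2; lra.
Qed.

Lemma kernel_D1_bound x y u : `|'D_u (k ^~ y) x| <= B ^+ 2 * enorm u.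
Proof.
have n01 : enorm (0 : 'rV[R]_n) <= 1 by rewrite enorm0.
apply: (homogeneous_bound (q := fun u => `|'D_u (k ^~ y) x|)) => [a v|v v1].
  exact: norm_derive_scale.
by have [_ h _ _] := kB x y v1 n01.
Qed.

Lemma kernel_D11_bound x y u v :
  `|'D_v ('D_u (k ^~ y)) x| <= B ^+ 2 * enorm u * enorm v.
Proof.
apply: (homogeneous_bound (q := fun v => `|'D_v ('D_u (k ^~ y)) x|)) => [a w|w w1].
  exact: norm_derive_scale.
apply: (homogeneous_bound (q := fun u => `|'D_w ('D_u (k ^~ y)) x|)) => [a t|t t1].
  exact: norm_derive2_scalel.
by have [_ _ h _] := kB x y t1 w1; exact: h.
Qed.

Lemma kernel_D12_bound x y u v :
  `|'D_v (fun y' => 'D_u (k ^~ y') x) y| <= B ^+ 2 * enorm u * enorm v.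
Proof.
apply: (homogeneous_bound
  (q := fun v => `|'D_v (fun y' => 'D_u (k ^~ y') x) y|)) => [a w|w w1].
  exact: norm_derive_scale.
apply: (homogeneous_bound
  (q := fun u => `|'D_w (fun y' => 'D_u (k ^~ y') x) y|)) => [a t|t t1].
  have -> : (fun y' => 'D_(a *: t) (k ^~ y') x) =
            (fun y' => a *: 'D_t (k ^~ y') x).
    by apply/funext => y'; rewrite derive_scale.
  by rewrite (@derive_funZ _ _ _ (fun y' => 'D_t (k ^~ y') x))// normrM.
by have [_ _ _ h] := kB x y t1 w1; exact: h.
Qed.

Lemma kernel_sym x y : k x y = k y x.
Proof. by have [_ []] := k_psd. Qed.

Lemma kernel_lipschitz x y h l :
  `|k (x + h) (y + l) - k x y| <= B ^+ 2 * (enorm h + enorm l).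
Proof.
have h1 : `|k (x + h) (y + l) - k x (y + l)| <= B ^+ 2 * enorm h.
  by apply: (@mean_value_bound _ _ (k ^~ (y + l))) => // z; exact: kernel_D1_bound.
have h2 : `|k (y + l) x - k y x| <= B ^+ 2 * enorm l.
  by apply: (@mean_value_bound _ _ (k ^~ x)) => // z; exact: kernel_D1_bound.
move: h1 h2; rewrite (kernel_sym _ x) (kernel_sym y x) mulrDr !ler_norml; lra.
Qed.

(* The increment in the second argument is expanded by the symmetry of [k],
   so that only derivatives in the first argument occur. *)
Lemma kernel_taylor x y h l :
  `|k (x + h) (y + l) - k x y - ('D_h (k ^~ y) x + 'D_l (k ^~ x) y)|
    <= B ^+ 2 * (enorm h + enorm l) ^+ 2.
Proof.
have b0 : 0 <= B ^+ 2 by exact: sqr_ge0.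
have h0 := enorm_ge0 h; have l0 := enorm_ge0 l.
have h1 : `|k (x + h) (y + l) - k x (y + l) - 'D_h (k ^~ (y + l)) x|
    <= B ^+ 2 * enorm h * enorm h.
  apply: (@taylor_bound _ _ (k ^~ (y + l))) => // z; exact: kernel_D11_bound.
have h2 : `|k (y + l) x - k y x - 'D_l (k ^~ x) y| <= B ^+ 2 * enorm l * enorm l.
  by apply: (@taylor_bound _ _ (k ^~ x)) => // z; exact: kernel_D11_bound.
(* The first argument was expanded with the second one already moved; bringing its differential back
   to [y] costs the mixed second derivative. *)
have h3 : `|'D_h (k ^~ (y + l)) x - 'D_h (k ^~ y) x| <= B ^+ 2 * enorm h * enorm l.
  apply: (@mean_value_bound _ _ (fun y' => 'D_h (k ^~ y') x)) => // z.
  exact: kernel_D12_bound.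
have E : B ^+ 2 * (enorm h + enorm l) ^+ 2 =
  B ^+ 2 * enorm h * enorm h + B ^+ 2 * enorm l * enorm l
  + 2 * (B ^+ 2 * enorm h * enorm l) by ring.
have hl : 0 <= B ^+ 2 * enorm h * enorm l by rewrite mulr_ge0// mulr_ge0.
move: h1 h2 h3 hl; rewrite E (kernel_sym _ x) (kernel_sym y x) !ler_norml; lra.
Qed.

End Kernel.

(** * The score, its differential and its Taylor bounds *)

Section Score.
Context {R : realType}.
Variables (n : nat) (f : 'rV[R]_n -> R) (L M : R).
Hypothesis f_C3 : C3 f.
Hypothesis fLM : forall x (u v w : 'rV[R]_n),
  enorm u <= 1 -> enorm v <= 1 -> enorm w <= 1 ->
  `|'D_u ('D_v f) x| <= L /\ `|'D_u ('D_v ('D_w f)) x| <= M.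

Let df x : differentiable f x. Proof. by have [] := f_C3. Qed.
Let ddf u x : differentiable ('D_u f) x. Proof. by have [_ []] := f_C3. Qed.
Let dddf u v x : differentiable ('D_u ('D_v f)) x.
Proof. by have [_ [_ []]] := f_C3. Qed.

(** The differential of the score [grad f] at [x] in direction [u]. *)
Definition hess_apply (x u : 'rV[R]_n) : 'rV[R]_n :=
  \row_i 'D_u ('D_(evec i) f) x.

Lemma hess_applyE x u i : hess_apply x u 0 i = 'D_u ('D_(evec i) f) x.
Proof. by rewrite mxE. Qed.

Lemma hess_apply_linear x : linear (hess_apply x).
Proof.
move=> a u v; apply/rowP => i.
rewrite hess_applyE (derive_linear_fun a u v (ddf (evec i) x)).
rewrite [RHS]mxE [X in _ = X + _]mxE; congr (a * _ + _);
  by symmetry; exact: hess_applyE.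
Qed.

Lemma derive_sum_evec x e : 'D_e f x = \sum_(i < n) e 0 i * 'D_(evec i) f x.
Proof.
rewrite {1}(rowvec_sum e) deriveE// linear_sum.
by apply: eq_bigr => i _; rewrite linearZ -deriveE.
Qed.

Lemma dotv_grad x e : dotv (grad f x) e = 'D_e f x.
Proof.
rewrite derive_sum_evec /dotv; apply: eq_bigr => i _.
by rewrite /grad mxE mulrC.
Qed.

Lemma dotv_hess_apply x u e : dotv (hess_apply x u) e = 'D_u ('D_e f) x.
Proof.
have -> : 'D_e f = \sum_(i < n) (e 0 i \*: 'D_(evec i) f).
  by apply/funext => y; rewrite fct_sumE; exact: derive_sum_evec.
rewrite derive_sum => [|i]; last exact/derivableZ/diff_derivable.
rewrite /dotv; apply: eq_bigr => i _; rewrite hess_applyE deriveZ; last first.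
  exact: diff_derivable.
by rewrite mulrC.
Qed.

Lemma D2_bound x u v : `|'D_u ('D_v f) x| <= L * enorm u * enorm v.
Proof.
have n01 : enorm (0 : 'rV[R]_n) <= 1 by rewrite enorm0.
apply: (homogeneous_bound (q := fun v => `|'D_u ('D_v f) x|)) => [a w|w w1].
  exact: (norm_derive2_scalel a w u x df ddf).
apply: (homogeneous_bound (q := fun u => `|'D_u ('D_w f) x|)) => [a t|t t1].
  exact: (norm_derive_scale a t (ddf w x)).
exact: (fLM x t1 w1 n01).1.
Qed.

Lemma D3_bound x u v w :
  `|'D_u ('D_v ('D_w f)) x| <= M * enorm u * enorm v * enorm w.
Proof.
apply: (homogeneous_bound (q := fun w => `|'D_u ('D_v ('D_w f)) x|)) => [a t|t t1].
  exact: (norm_derive3_scalel a u v t x df ddf dddf).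
apply: (homogeneous_bound (q := fun v => `|'D_u ('D_v ('D_t f)) x|)) => [a s|s s1].
  exact: (norm_derive2_scalel a s u x (ddf t) (fun w => dddf w t)).
apply: (homogeneous_bound (q := fun u => `|'D_u ('D_s ('D_t f)) x|)) => [a r|r r1].
  exact: (norm_derive_scale a r (dddf s t x)).
exact: (fLM x r1 s1 t1).2.
Qed.

Lemma hess_bound_ge0 : 0 <= L.
Proof.
have n01 : enorm (0 : 'rV[R]_n) <= 1 by rewrite enorm0.
by have [h _] := fLM 0 n01 n01 n01; exact: le_trans (normr_ge0 _) h.
Qed.

Lemma third_bound_ge0 : 0 <= M.
Proof.
have n01 : enorm (0 : 'rV[R]_n) <= 1 by rewrite enorm0.
by have [_ h] := fLM 0 n01 n01 n01; exact: le_trans (normr_ge0 _) h.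
Qed.

Lemma hess_apply_bound x u : enorm (hess_apply x u) <= L * enorm u.
Proof.
apply: enorm_dual => [|e]; first by rewrite mulr_ge0 ?hess_bound_ge0 ?enorm_ge0.
by rewrite dotv_hess_apply; apply: le_trans (ler_norm _) (D2_bound _ _ _).
Qed.

Lemma grad_lipschitz x h : enorm (grad f (x + h) - grad f x) <= L * enorm h.
Proof.
apply: enorm_dual => [|e]; first by rewrite mulr_ge0 ?hess_bound_ge0 ?enorm_ge0.
rewrite dotvBl !dotv_grad; apply: le_trans (ler_norm _) _.
exact: (mean_value_bound x (ddf e) (fun y => D2_bound y h e)).
Qed.

(** Pairing with [e] turns the score into the scalar function ['D_e f], whose second derivatives
    along [h] are third derivatives of [f]. *)
Lemma grad_taylor x h :
  enorm (grad f (x + h) - grad f x - hess_apply x h) <= M * enorm h ^+ 2.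
Proof.
apply: enorm_dual => [|e].
  by rewrite mulr_ge0 ?third_bound_ge0 ?exprn_ge0 ?enorm_ge0.
rewrite !dotvBl !dotv_grad dotv_hess_apply; apply: le_trans (ler_norm _) _.
apply: (taylor_bound x (ddf e) (dddf h e)) => y.
by rewrite expr2 mulrA; exact: D3_bound.
Qed.

End Score.

(** * Smooth vector maps *)

Section Smooth_vector_map.
Context {R : realType}.
Variables (m n : nat) (V : 'rV[R]_m -> 'rV[R]_n) (a : R).
Hypothesis dV : forall x, differentiable V x.
Hypothesis ddV : forall v x, differentiable ('D_v V) x.
Hypothesis Va : forall x (v w : 'rV[R]_m), enorm v <= 1 -> enorm w <= 1 ->
  enorm ('D_v V x) <= a /\ enorm ('D_w ('D_v V) x) <= a.

Lemma map_bound_ge0 : 0 <= a.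
Proof.
have n01 : enorm (0 : 'rV[R]_m) <= 1 by rewrite enorm0.
by have [h _] := Va 0 n01 n01; exact: le_trans (enorm_ge0 _) h.
Qed.

Lemma map_D1_bound x v : enorm ('D_v V x) <= a * enorm v.
Proof.
have n01 : enorm (0 : 'rV[R]_m) <= 1 by rewrite enorm0.
apply: (homogeneous_bound (q := fun v => enorm ('D_v V x))) => [c u|u u1].
  exact: etrans (congr1 _ (derive_scale c u (dV x))) (enormZ _ _).
exact: (Va x u1 n01).1.
Qed.

Lemma map_D2_bound x v w : enorm ('D_w ('D_v V) x) <= a * enorm v * enorm w.
Proof.
apply: (homogeneous_bound (q := fun w => enorm ('D_w ('D_v V) x))) => [c u|u u1].
  exact: etrans (congr1 _ (derive_scale c u (ddV v x))) (enormZ _ _).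
apply: (homogeneous_bound (q := fun v => enorm ('D_u ('D_v V) x))) => [c t|t t1].
  exact: etrans (congr1 _ (derive2_scalel c t u x dV ddV)) (enormZ _ _).
exact: (Va x t1 u1).2.
Qed.

Lemma map_increment x v : enorm (V (x + v) - V x) <= a * enorm v.
Proof.
apply: mean_value_bound_vec => [||y].
- by rewrite mulr_ge0 ?map_bound_ge0 ?enorm_ge0.
- exact: dV.
- exact: map_D1_bound.
Qed.

Lemma map_remainder x v :
  enorm (V (x + v) - V x - 'D_v V x) <= a * enorm v ^+ 2.
Proof.
apply: taylor_bound_vec => [|||y].
- by rewrite mulr_ge0 ?map_bound_ge0// exprn_ge0 ?enorm_ge0.
- exact: dV.
- exact: ddV.
- by rewrite expr2 mulrA; exact: map_D2_bound.
Qed.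

End Smooth_vector_map.

(** * Entrywise products and reciprocals *)

Section Hadamard.
Context {R : realType}.
Variable n : nat.
Implicit Types u v x : 'rV[R]_n.

Lemma hadamDl u v x : hadam (u + v) x = hadam u x + hadam v x.
Proof. by apply/rowP => i; rewrite !mxE mulrDl. Qed.

Lemma hadamZl c u x : hadam (c *: u) x = c *: hadam u x.
Proof. by apply/rowP => i; rewrite !mxE mulrA. Qed.

Lemma hadamBl u v x : hadam (u - v) x = hadam u x - hadam v x.
Proof. by apply/rowP => i; rewrite !mxE mulrBl. Qed.

Lemma enorm_hadam u x b : 0 <= b -> (forall i, `|x 0 i| <= b) ->
  enorm (hadam u x) <= b * enorm u.
Proof.
move=> b0 xb; apply: enorm_le_coord => // i; rewrite mxE normrM mulrC.
by rewrite ler_wpM2r.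
Qed.

(** The differential of the map from [s] to [ediv x s], in direction [v]. *)
Definition ediv_deriv (x s v : 'rV[R]_n) : 'rV[R]_n := \row_i (- (x 0 i * v 0 i / s 0 i ^+ 2)).

Lemma ediv_deriv_linear x s : linear (ediv_deriv x s).
Proof. by move=> c u v; apply/rowP => i; rewrite !mxE; ring. Qed.

Section Reciprocal.
Variables (x s t : 'rV[R]_n) (b L : R).
Hypothesis L0 : 0 < L.
Hypothesis xb : forall i, `|x 0 i| <= b.
Hypothesis sL : forall i, 1 / Num.sqrt L <= s 0 i.
Hypothesis tL : forall i, 1 / Num.sqrt L <= t 0 i.
Hypothesis b0 : 0 <= b.

Let r := Num.sqrt L.
Let r0 : 0 < r. Proof. by rewrite sqrtr_gt0. Qed.
Let rr : r * r = L. Proof. by rewrite -expr2 sqr_sqrtr// ltW. Qed.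

Let inv_bound y : 1 / r <= y -> y != 0 /\ 0 < y^-1 <= r.
Proof.
move=> ry; have y0 : 0 < y by apply: lt_le_trans ry; rewrite divr_gt0.
rewrite gt_eqF// invr_gt0 y0; split => //=.
by rewrite -[r]invrK lef_pV2 ?posrE ?invr_gt0// -div1r.
Qed.

Lemma ediv_increment : enorm (ediv x t - ediv x s) <= b * L * enorm (t - s).
Proof.
apply: enorm_le_coord => [|i]; first by rewrite mulr_ge0// ltW.
have [s0 /andP[si0 sir]] := inv_bound (sL i).
have [t0 /andP[ti0 tir]] := inv_bound (tL i).
rewrite !mxE.
have -> : x 0 i / t 0 i - x 0 i / s 0 i
  = - (x 0 i * ((s 0 i)^-1 * (t 0 i)^-1) * (t 0 i - s 0 i)).
  by field; rewrite s0 t0.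
rewrite normrN 2!normrM ler_wpM2r// ler_pM// -rr normrM !gtr0_norm//.
by rewrite ler_pM// ltW.
Qed.

(** Here [v] is the linearised increment of [sigma], not [t - s]. The error therefore splits into
    the exact second order error [p] of the reciprocal, with three reciprocals and hence [L * r],
    and the defect [q] of the linearisation, with two reciprocals and hence [L]. *)
Lemma ediv_remainder (v : 'rV[R]_n) :
  enorm (ediv x t - ediv x s - ediv_deriv x s v)
    <= b * (L * r) * enorm (t - s) ^+ 2 + b * L * enorm (t - s - v).
Proof.
pose p := \row_i (x 0 i * (t 0 i - s 0 i) ^+ 2
  * ((s 0 i)^-1 * (s 0 i)^-1 * (t 0 i)^-1)) : 'rV[R]_n.
pose q := \row_i (x 0 i * (t 0 i - s 0 i - v 0 i) * ((s 0 i)^-1 * (s 0 i)^-1))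
  : 'rV[R]_n.
have -> : ediv x t - ediv x s - ediv_deriv x s v = p - q.
  apply/rowP => i; rewrite !mxE.
  have [s0 _] := inv_bound (sL i); have [t0 _] := inv_bound (tL i).
  by field; rewrite s0 t0.
apply: le_trans (enormB _ _) _; apply: lerD.
  rewrite expr2 mulrA; apply: enorm_le_coord => [|i].
    by rewrite !mulr_ge0 ?enorm_ge0// ltW.
  have [s0 /andP[si0 sir]] := inv_bound (sL i).
  have [t0 /andP[ti0 tir]] := inv_bound (tL i).
  have h1 : `|t 0 i - s 0 i| <= enorm (t - s).
    by have := coord_le_enorm (t - s) i; rewrite !mxE.
  have h2 : `|(s 0 i)^-1 * (s 0 i)^-1 * (t 0 i)^-1| <= L * r.
    by rewrite -rr !normrM !gtr0_norm// !ler_pM// ?mulr_ge0// ltW.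
  rewrite /p !mxE 2!normrM normrX.
  have -> : `|x 0 i| * `|t 0 i - s 0 i| ^+ 2
      * `|(s 0 i)^-1 * (s 0 i)^-1 * (t 0 i)^-1|
    = `|x 0 i| * `|(s 0 i)^-1 * (s 0 i)^-1 * (t 0 i)^-1|
      * `|t 0 i - s 0 i| * `|t 0 i - s 0 i| by ring.
  by rewrite ler_wpM2r// !ler_pM// mulr_ge0.
apply: enorm_le_coord => [|i]; first by rewrite mulr_ge0// ltW.
have [s0 /andP[si0 sir]] := inv_bound (sL i).
rewrite /q !mxE !normrM mulrAC ler_wpM2r// ler_pM// ?mulr_ge0//.
by rewrite -rr !gtr0_norm// ler_pM// ltW.
Qed.

End Reciprocal.
End Hadamard.

(** * One sample *)

(** One outcome is frozen, so that [mu] and [sg] depend on the parameter only. In the application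
    [a] is [G * (1 + enorm z)] and [b] bounds the noise coordinates. The draw then moves at speed
    [a * (1 + b)], and [1 <= a] allows first powers of this speed to be bounded by its square. *)
Definition is_sample_bound (R : realType) m d (mu sg : 'rV[R]_m -> 'rV[R]_d)
    (xi : 'rV[R]_d) (L a b : R) :=
  [/\ [/\ forall x, differentiable mu x,
          forall v x, differentiable ('D_v mu) x,
          forall x, differentiable sg x &
          forall v x, differentiable ('D_v sg) x],
      forall x (v w : 'rV[R]_m), enorm v <= 1 -> enorm w <= 1 ->
        [/\ enorm ('D_v mu x) <= a, enorm ('D_w ('D_v mu) x) <= a,
            enorm ('D_v sg x) <= a & enorm ('D_w ('D_v sg) x) <= a],
      forall x i, 1 / Num.sqrt L <= sg x 0 i,
      forall i, `|xi 0 i| <= b & 1 <= a /\ 0 <= b].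

Section Sample.
Context {R : realType}.
Variables (m d : nat) (mu sg : 'rV[R]_m -> 'rV[R]_d) (xi : 'rV[R]_d).
Variables (f : 'rV[R]_d -> R) (L M a b : R).
Hypothesis L0 : 0 < L.
Hypothesis f_C3 : C3 f.
Hypothesis fLM : forall x (u v w : 'rV[R]_d),
  enorm u <= 1 -> enorm v <= 1 -> enorm w <= 1 ->
  `|'D_u ('D_v f) x| <= L /\ `|'D_u ('D_v ('D_w f)) x| <= M.
Hypothesis sample : is_sample_bound mu sg xi L a b.

Let A := a * (1 + b).

Let dmu x : differentiable mu x. Proof. by have [[]] := sample. Qed.
Let ddmu v x : differentiable ('D_v mu) x.
Proof. by have [[_ h _ _] _ _ _ _] := sample; exact: h. Qed.
Let dsg x : differentiable sg x.
Proof. by have [[_ _ h _] _ _ _ _] := sample; exact: h. Qed.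
Let ddsg v x : differentiable ('D_v sg) x.
Proof. by have [[_ _ _ h] _ _ _ _] := sample; exact: h. Qed.
Let mua x (v w : 'rV[R]_m) : enorm v <= 1 -> enorm w <= 1 ->
  enorm ('D_v mu x) <= a /\ enorm ('D_w ('D_v mu) x) <= a.
Proof.
by have [_ h _ _ _] := sample => v1 w1; have [h1 h2 _ _] := h x v w v1 w1; split.
Qed.
Let sga x (v w : 'rV[R]_m) : enorm v <= 1 -> enorm w <= 1 ->
  enorm ('D_v sg x) <= a /\ enorm ('D_w ('D_v sg) x) <= a.
Proof.
by have [_ h _ _ _] := sample => v1 w1; have [_ _ h1 h2] := h x v w v1 w1; split.
Qed.
Let sgL x i : 1 / Num.sqrt L <= sg x 0 i.
Proof. by have [_ _ h _ _] := sample. Qed.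
Let xib i : `|xi 0 i| <= b. Proof. by have [_ _ _ h _] := sample. Qed.
Let a1 : 1 <= a. Proof. by have [_ _ _ _ []] := sample. Qed.
Let b0 : 0 <= b. Proof. by have [_ _ _ _ []] := sample. Qed.

Lemma sample_scale_ge1 : 1 <= A.
Proof. by rewrite /A; move: a1 b0; nra. Qed.

Definition draw x := mu x + hadam (sg x) xi.
Definition draw_deriv x v := 'D_v mu x + hadam ('D_v sg x) xi.
Definition noisy_score x := grad f (draw x) + ediv xi (sg x).
Definition noisy_score_deriv x v :=
  hess_apply f (draw x) (draw_deriv x v) + ediv_deriv xi (sg x) ('D_v sg x).

Lemma draw_deriv_linear x : linear (draw_deriv x).
Proof.
move=> c u v; rewrite /draw_deriv (derive_linear (dmu x) c u v).
rewrite (derive_linear (dsg x) c u v) hadamDl hadamZl scalerDr.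
exact: addrACA.
Qed.

Lemma noisy_score_deriv_linear x : linear (noisy_score_deriv x).
Proof.
move=> c u v; rewrite /noisy_score_deriv draw_deriv_linear.
rewrite (hess_apply_linear f_C3 (draw x) c (draw_deriv x u) (draw_deriv x v)).
rewrite (derive_linear (dsg x) c u v) ediv_deriv_linear scalerDr.
exact: addrACA.
Qed.

Let scale_split p q c : p <= a * c -> q <= b * (a * c) -> p + q <= A * c.
Proof. by rewrite /A; lra. Qed.

Lemma draw_increment x v : enorm (draw (x + v) - draw x) <= A * enorm v.
Proof.
have -> : draw (x + v) - draw x = (mu (x + v) - mu x)
    + hadam (sg (x + v) - sg x) xi.
  by rewrite /draw hadamBl opprD addrACA.
apply: le_trans (enormD _ _) _.
have h1 := map_increment dmu mua x v.
have h2 := map_increment dsg sga x v.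
have h3 := enorm_hadam (sg (x + v) - sg x) b0 xib.
exact: (scale_split h1 (le_trans h3 (ler_wpM2l b0 h2))).
Qed.

Lemma draw_remainder x v :
  enorm (draw (x + v) - draw x - draw_deriv x v) <= A * enorm v ^+ 2.
Proof.
have -> : draw (x + v) - draw x - draw_deriv x v = (mu (x + v) - mu x - 'D_v mu x)
    + hadam (sg (x + v) - sg x - 'D_v sg x) xi.
  rewrite /draw /draw_deriv; move: (mu _) (mu _) (sg _) (sg _) ('D_v mu _)
    ('D_v sg _) => p1 p2 p3 p4 p5 p6.
  by apply/rowP => i; rewrite !mxE; ring.
apply: le_trans (enormD _ _) _.
have h1 := map_remainder dmu ddmu mua x v.
have h2 := map_remainder dsg ddsg sga x v.
have h3 := enorm_hadam (sg (x + v) - sg x - 'D_v sg x) b0 xib.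
exact: (scale_split h1 (le_trans h3 (ler_wpM2l b0 h2))).
Qed.

(** The score contributes [L] times the speed of the draw. The reciprocal contributes [b * L] times
    the speed [a] of [sg], and [b * a <= A]; hence the factor 2. *)
Lemma noisy_score_increment x v :
  enorm (noisy_score (x + v) - noisy_score x) <= 2 * L * A * enorm v.
Proof.
rewrite /noisy_score opprD addrACA; apply: le_trans (enormD _ _) _.
have hX := draw_increment x v.
have := grad_lipschitz f_C3 fLM (draw x) (draw (x + v) - draw x).
rewrite (addrC (draw x)) subrK => hs.
have he := ediv_increment L0 xib (sgL x) (sgL (x + v)) b0.
have hsg := map_increment dsg sga x v.
have v0 := enorm_ge0 v.
have h1 : L * enorm (draw (x + v) - draw x) <= L * (A * enorm v).
  by rewrite ler_wpM2l// ltW.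
have bL : 0 <= b * L by rewrite mulr_ge0// ltW.
have h2 : b * L * enorm (sg (x + v) - sg x) <= b * L * (a * enorm v).
  by rewrite ler_wpM2l.
have h3 : b * L * (a * enorm v) <= L * (A * enorm v).
  have -> : b * L * (a * enorm v) = L * (b * a * enorm v) by ring.
  by rewrite ler_wpM2l ?(ltW L0)// ler_wpM2r// /A; move: a1; nra.
have -> : 2 * L * A * enorm v = L * (A * enorm v) + L * (A * enorm v) by ring.
apply: lerD; first exact: le_trans hs h1.
exact: le_trans he (le_trans h2 h3).
Qed.

(** There are four errors: the Taylor error of the score ([M]), the Hessian applied to the remainder
    of the draw ([L]), the second order error of the reciprocal ([L * sqrt L]) and the remainder of
    [sg] inside it ([L]). *)
Lemma noisy_score_remainder x v :
  enorm (noisy_score (x + v) - noisy_score x - noisy_score_deriv x v)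
    <= (M + 2 * L + L * Num.sqrt L) * A ^+ 2 * enorm v ^+ 2.
Proof.
set h := draw (x + v) - draw x.
have E : draw x + h = draw (x + v) by rewrite (addrC (draw x)) subrK.
have EF : noisy_score (x + v) - noisy_score x - noisy_score_deriv x v
  = (grad f (draw x + h) - grad f (draw x) - hess_apply f (draw x) h)
    + hess_apply f (draw x) (h - draw_deriv x v)
    + (ediv xi (sg (x + v)) - ediv xi (sg x) - ediv_deriv xi (sg x) ('D_v sg x)).
  have -> : hess_apply f (draw x) (h - draw_deriv x v) =
      hess_apply f (draw x) h - hess_apply f (draw x) (draw_deriv x v).
    have := hess_apply_linear f_C3 (draw x) (-1) (draw_deriv x v) h.
    by rewrite !scaleN1r => E'; rewrite [h - _]addrC E' addrC.
  rewrite E /noisy_score /noisy_score_deriv.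
  move: (grad f _) (grad f _) (hess_apply _ _ _) (hess_apply _ _ _) (ediv _ _)
    (ediv _ _) (ediv_deriv _ _ _) => p1 p2 p3 p4 p5 p6 p7.
  by apply/rowP => i; rewrite !mxE; ring.
rewrite EF; apply: le_trans (enormD _ _) _.
have v0 := enorm_ge0 v; have v20 : 0 <= enorm v ^+ 2 by exact: exprn_ge0.
have A1 := sample_scale_ge1.
have M0 := third_bound_ge0 fLM.
have r0 : 0 <= Num.sqrt L by exact: sqrtr_ge0.
have hX : enorm h <= A * enorm v by exact: draw_increment.
have A0 : 0 <= A by exact: le_trans A1.
have h1 : enorm (grad f (draw x + h) - grad f (draw x) - hess_apply f (draw x) h)
    <= M * (A ^+ 2 * enorm v ^+ 2).
  apply: le_trans (grad_taylor f_C3 fLM _ _) _.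
  apply: (ler_wpM2l M0); rewrite -exprMn; apply: lerXn2r hX => //.
    exact: enorm_ge0.
  exact: mulr_ge0.
have h2 : enorm (hess_apply f (draw x) (h - draw_deriv x v))
    <= L * (A * enorm v ^+ 2).
  apply: le_trans (hess_apply_bound f_C3 fLM _ _) _.
  by apply: (ler_wpM2l (ltW L0)); exact: draw_remainder.
have h3 := ediv_remainder L0 xib (sgL x) (sgL (x + v)) b0 ('D_v sg x).
have hsg := map_increment dsg sga x v.
have hrsg := map_remainder dsg ddsg sga x v.
have a0 : 0 <= a by exact: le_trans a1.
have hsg2 : enorm (sg (x + v) - sg x) ^+ 2 <= a ^+ 2 * enorm v ^+ 2.
  rewrite -exprMn; apply: lerXn2r hsg => //; first exact: enorm_ge0.
  exact: mulr_ge0.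
have AA : A <= A ^+ 2 by rewrite expr2 ler_peMl.
have ba : b * a <= A by rewrite /A; move: a1; nra.
have h4 : b * (L * Num.sqrt L) * enorm (sg (x + v) - sg x) ^+ 2
    <= (L * Num.sqrt L) * (A ^+ 2 * enorm v ^+ 2).
  have Lr0 : 0 <= L * Num.sqrt L by rewrite mulr_ge0// ltW.
  have -> : forall q, b * (L * Num.sqrt L) * q = L * Num.sqrt L * (b * q).
    by move=> q; ring.
  apply: (ler_wpM2l Lr0); apply: le_trans (ler_wpM2l b0 hsg2) _.
  rewrite mulrA; apply: (ler_wpM2r v20).
  by rewrite /A exprMn mulrC; apply: (ler_wpM2l (sqr_ge0 a)); move: b0; nra.
have h5 : b * L * enorm (sg (x + v) - sg x - 'D_v sg x)
    <= L * (A * enorm v ^+ 2).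
  have -> : forall q, b * L * q = L * (b * q) by move=> q; ring.
  apply: (ler_wpM2l (ltW L0)); apply: le_trans (ler_wpM2l b0 hrsg) _.
  by rewrite mulrA (ler_wpM2r v20).
have h6 : L * (A * enorm v ^+ 2) <= L * (A ^+ 2 * enorm v ^+ 2).
  by rewrite ler_wpM2l ?(ltW L0)// ler_wpM2r.
have -> : (M + 2 * L + L * Num.sqrt L) * A ^+ 2 * enorm v ^+ 2
  = (M * (A ^+ 2 * enorm v ^+ 2) + L * (A ^+ 2 * enorm v ^+ 2))
    + (L * Num.sqrt L * (A ^+ 2 * enorm v ^+ 2) + L * (A ^+ 2 * enorm v ^+ 2)).
  by ring.
apply: lerD.
  exact: le_trans (enormD _ _) (lerD h1 (le_trans h2 h6)).
exact: le_trans h3 (lerD h4 (le_trans h5 h6)).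
Qed.

End Sample.

(** * The integrand *)

Section Product_remainder.
Context {R : realType}.

(** The grouping makes each term of second order, and the only scores that occur outside a
    difference are [F1], [G1] and [G2]. *)
Lemma product_remainder n (k1 k2 dk1 : R) (F1 F2 G1 G2 dF1 dG1 : 'rV[R]_n) :
  k2 * dotv F2 G2 - k1 * dotv F1 G1
    - (dk1 * dotv F1 G1 + k1 * (dotv dF1 G1 + dotv F1 dG1)) =
  (k2 - k1 - dk1) * dotv F1 G1
  + (k2 - k1) * (dotv (F2 - F1) G2 + dotv F1 (G2 - G1))
  + k1 * (dotv (F2 - F1 - dF1) G1 + dotv (F2 - F1) (G2 - G1)
          + dotv F1 (G2 - G1 - dG1)).
Proof. rewrite !(dotvBl, dotvBr); ring. Qed.

Lemma product_remainder_bound n (k1 k2 dk1 A A' B L M t : R)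
    (F1 F2 F1' F2' dF1 dF1' : 'rV[R]_n) :
  0 <= t -> 0 <= L -> 0 <= M -> 1 <= A -> 1 <= A' ->
  `|k1| <= B ^+ 2 -> `|k2 - k1| <= B ^+ 2 * ((A + A') * t) ->
  `|k2 - k1 - dk1| <= 2 * B ^+ 2 * (A + A') ^+ 2 * t ^+ 2 ->
  enorm (F2 - F1) <= 2 * L * A * t -> enorm (F2' - F1') <= 2 * L * A' * t ->
  enorm (F2 - F1 - dF1) <= (M + 2 * L + L * Num.sqrt L) * A ^+ 2 * t ^+ 2 ->
  enorm (F2' - F1' - dF1') <= (M + 2 * L + L * Num.sqrt L) * A' ^+ 2 * t ^+ 2 ->
  `|k2 * dotv F2 F2' - k1 * dotv F1 F1'
     - (dk1 * dotv F1 F1' + k1 * (dotv dF1 F1' + dotv F1 dF1'))|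
  <= B ^+ 2 * (A + A') ^+ 2
     * (2 * (enorm F1 + enorm F1' + enorm F2') ^+ 2
        + 55 * (M ^+ 2 + Num.max 1 L ^+ 3)) * t ^+ 2.
Proof.
move=> t0 L0' M0 A1 A1' hk1 hdk hk hF hF' hr hr'; rewrite product_remainder.
have p0 := enorm_ge0 F1; have p0' := enorm_ge0 F1'; have q0 := enorm_ge0 F2'.
have rr : Num.sqrt L ^+ 2 = L by rewrite sqr_sqrtr.
have r0 : 0 <= Num.sqrt L by exact: sqrtr_ge0.
move: (k2 - k1 - dk1) hk => rk hk; move: (k2 - k1) hdk => Dk hdk.
move: (F2 - F1 - dF1) (F2' - F1' - dF1') hr hr' => rF rF' hr hr'.
move: (F2 - F1) (F2' - F1') hF hF' => DF DF' hF hF'.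
move: (Num.sqrt L) r0 rr hr hr' => r r0 rr hr hr'.
have c1 := cauchy_schwarz F1 F1'.
have c2 := cauchy_schwarz DF F2'.
have c3 := cauchy_schwarz F1 DF'.
have c4 := cauchy_schwarz rF F1'.
have c5 := cauchy_schwarz DF DF'.
have c6 := cauchy_schwarz F1 rF'.
have n1 := enorm_ge0 DF; have n2 := enorm_ge0 DF'.
have n3 := enorm_ge0 rF; have n4 := enorm_ge0 rF'.
set S := A + A' in hk hdk *; set N := M + 2 * L + L * r in hr hr' *.
have S0 : 0 <= S by rewrite addr_ge0 ?(le_trans _ A1) ?(le_trans _ A1').
have AS : A <= S by rewrite lerDl (le_trans _ A1').
have AS' : A' <= S by rewrite lerDr (le_trans _ A1).
have A0 : 0 <= A by exact: le_trans A1.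
have A0' : 0 <= A' by exact: le_trans A1'.
have N0 : 0 <= N by rewrite /N !addr_ge0 ?mulr_ge0.
have LA : 2 * L * A * t <= 2 * L * S * t.
  by apply: (ler_wpM2r t0); apply: ler_wpM2l => //; rewrite mulr_ge0.
have LA' : 2 * L * A' * t <= 2 * L * S * t.
  by apply: (ler_wpM2r t0); apply: ler_wpM2l => //; rewrite mulr_ge0.
have NA : N * A ^+ 2 * t ^+ 2 <= N * S ^+ 2 * t ^+ 2.
  apply: ler_wpM2r; first exact: exprn_ge0.
  by apply: (ler_wpM2l N0); exact: lerXn2r.
have NA' : N * A' ^+ 2 * t ^+ 2 <= N * S ^+ 2 * t ^+ 2.
  apply: ler_wpM2r; first exact: exprn_ge0.
  by apply: (ler_wpM2l N0); exact: lerXn2r.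
have {}hF := le_trans hF LA; have {}hF' := le_trans hF' LA'.
have {}hr := le_trans hr NA; have {}hr' := le_trans hr' NA'.
clear LA LA' NA NA'.
have t1 : `|rk * dotv F1 F1'| <= 2 * B ^+ 2 * S ^+ 2 * t ^+ 2 * (enorm F1 * enorm F1').
  by rewrite normrM; exact: (ler_pM (normr_ge0 _) (normr_ge0 _) hk c1).
have t2 : `|Dk * (dotv DF F2' + dotv F1 DF')| <=
    B ^+ 2 * (S * t) * (2 * L * S * t * enorm F2' + enorm F1 * (2 * L * S * t)).
  rewrite normrM; apply: (ler_pM (normr_ge0 _) (normr_ge0 _) hdk).
  apply: le_trans (ler_normD _ _) _; apply: lerD.
    by apply: le_trans c2 _; rewrite ler_wpM2r.
  by apply: le_trans c3 _; rewrite ler_wpM2l.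
have t3 : `|k1 * (dotv rF F1' + dotv DF DF' + dotv F1 rF')| <=
    B ^+ 2 * (N * S ^+ 2 * t ^+ 2 * enorm F1' + 2 * L * S * t * (2 * L * S * t)
              + enorm F1 * (N * S ^+ 2 * t ^+ 2)).
  rewrite normrM; apply: (ler_pM (normr_ge0 _) (normr_ge0 _) hk1).
  apply: le_trans (ler_normD _ _) _; apply: lerD.
    apply: le_trans (ler_normD _ _) _; apply: lerD.
      by apply: le_trans c4 _; rewrite ler_wpM2r.
    by apply: le_trans c5 _; rewrite ler_pM.
  by apply: le_trans c6 _; rewrite ler_wpM2l.
apply: le_trans (ler_normD _ _) _.
apply: le_trans (lerD (le_trans (ler_normD _ _) (lerD t1 t2)) t3) _.
clear t1 t2 t3 c1 c2 c3 c4 c5 c6 n1 n2 n3 n4 hF hF' hr hr' hk hdk hk1.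
move: (enorm F1) (enorm F1') (enorm F2') p0 p0' q0 => p p' q p0 p0' q0.
rewrite [leLHS](_ : _ = B ^+ 2 * S ^+ 2
   * (2 * (p * p') + 2 * L * (q + p) + N * (p + p') + 4 * L ^+ 2) * t ^+ 2); last by ring.
apply: ler_wpM2r; first exact: exprn_ge0.
apply: ler_wpM2l; first by rewrite mulr_ge0 ?sqr_ge0.
set W := M ^+ 2 + _.
have pp : 2 * (p * p') <= (p + p' + q) ^+ 2 by nra.
have lin : 2 * L * (q + p) + N * (p + p') <= (2 * L + N) * (p + p' + q).
  by have := mulr_ge0 L0' p0'; have := mulr_ge0 N0 q0; nra.
(* Products of scores and terms linear in them each contribute one square of the sum of norms,
   whence the factor 2 in front of it. *)
have young : (2 * L + N) * (p + p' + q) <= (p + p' + q) ^+ 2 + (2 * L + N) ^+ 2.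
  move: (2 * L + N) (p + p' + q) => y z; nra.
have [m1 mL] : 1 <= Num.max 1 L /\ L <= Num.max 1 L by rewrite !le_max !lexx orbT.
have m3 : L ^+ 2 <= Num.max 1 L ^+ 3 /\ L ^+ 3 <= Num.max 1 L ^+ 3.
  move: (Num.max 1 L) m1 mL => z z1 Lz; have z0 : 0 <= z by lra.
  split; last by exact: lerXn2r.
  apply: (@le_trans _ _ (z ^+ 2)); first exact: lerXn2r.
  by rewrite (exprS z 2); apply: ler_peMl => //; exact: sqr_ge0.
(* The left side is at most [3 * M^2 + (48 + 4) * L^2 + 3 * L^3]. Both powers of [L] are below the
   cube of [max 1 L], and 52 + 3 = 55. *)
have NW : (2 * L + N) ^+ 2 + 4 * L ^+ 2 <= 55 * W.
  have E3 : (L * r) ^+ 2 = L ^+ 3 by rewrite exprMn rr; ring.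
  have E4 : 2 * L + N = M + 4 * L + L * r by rewrite /N; ring.
  rewrite E4 /W; move: (L * r) E3 => y E3.
  have : (M + 4 * L + y) ^+ 2 <= 3 * M ^+ 2 + 48 * L ^+ 2 + 3 * y ^+ 2.
    have := sqr_ge0 (M - 4 * L); have := sqr_ge0 (M - y).
    by have := sqr_ge0 (4 * L - y); nra.
  by rewrite E3; have := sqr_ge0 M; move: m3; lra.
by lra.
Qed.

End Product_remainder.

Section Integrand.
Context {R : realType}.
Variables (m d : nat) (k : 'rV[R]_d -> 'rV[R]_d -> R) (f : 'rV[R]_d -> R).
Variables (B L M : R).
Hypothesis k_psd : cont_psd_kernel k.
Hypothesis dk : forall y x, differentiable (k ^~ y) x.
Hypothesis d11k : forall y u x, differentiable ('D_u (k ^~ y)) x.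
Hypothesis d12k : forall x u y, differentiable (fun y' => 'D_u (k ^~ y') x) y.
Hypothesis kB : forall x y (u v : 'rV[R]_d), enorm u <= 1 -> enorm v <= 1 ->
     [/\ k x y <= B ^+ 2,
         `|'D_u (k ^~ y) x| <= B ^+ 2,
         `|'D_v ('D_u (k ^~ y)) x| <= B ^+ 2
       & `|'D_v (fun y' => 'D_u (k ^~ y') x) y| <= B ^+ 2].
Hypothesis L0 : 0 < L.
Hypothesis f_C3 : C3 f.
Hypothesis fLM : forall x (u v w : 'rV[R]_d),
  enorm u <= 1 -> enorm v <= 1 -> enorm w <= 1 ->
  `|'D_u ('D_v f) x| <= L /\ `|'D_u ('D_v ('D_w f)) x| <= M.
Variables (mu sg mu' sg' : 'rV[R]_m -> 'rV[R]_d) (xi xi' : 'rV[R]_d).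
Variables (a b a' b' : R).
Hypothesis sample : is_sample_bound mu sg xi L a b.
Hypothesis sample' : is_sample_bound mu' sg' xi' L a' b'.

Local Notation X := (draw mu sg xi).
Local Notation X' := (draw mu' sg' xi').
Local Notation F := (noisy_score mu sg xi f).
Local Notation F' := (noisy_score mu' sg' xi' f).
Local Notation dX := (draw_deriv mu sg xi).
Local Notation dX' := (draw_deriv mu' sg' xi').
Local Notation dF := (noisy_score_deriv mu sg xi f).
Local Notation dF' := (noisy_score_deriv mu' sg' xi' f).
Let A := a * (1 + b).
Let A' := a' * (1 + b').

Definition integrand x := k (X x) (X' x) * dotv (F x) (F' x).

Definition kernel_deriv x v :=
  'D_(dX x v) (k ^~ (X' x)) (X x) + 'D_(dX' x v) (k ^~ (X x)) (X' x).

Definition integrand_deriv x v :=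
  kernel_deriv x v * dotv (F x) (F' x)
  + k (X x) (X' x) * (dotv (dF x v) (F' x) + dotv (F x) (dF' x v)).

Lemma kernel_deriv_linear x c u v :
  kernel_deriv x (c *: u + v) = c * kernel_deriv x u + kernel_deriv x v.
Proof.
rewrite /kernel_deriv (draw_deriv_linear sample) (draw_deriv_linear sample').
rewrite (derive_linear_fun c (dX x u) (dX x v) (dk (X' x) (X x))).
rewrite (derive_linear_fun c (dX' x u) (dX' x v) (dk (X x) (X' x))).
by rewrite mulrDr; exact: addrACA.
Qed.

Let affine_combine (c k1 k2 e l p q r s : R) :
  (c * k1 + k2) * e + l * (c * p + q + (c * r + s)) =
  c * (k1 * e + l * (p + r)) + (k2 * e + l * (q + s)).
Proof. ring. Qed.

Lemma integrand_deriv_linear x c u v :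
  integrand_deriv x (c *: u + v) = c * integrand_deriv x u + integrand_deriv x v.
Proof.
rewrite /integrand_deriv kernel_deriv_linear.
rewrite (noisy_score_deriv_linear f_C3 sample).
rewrite (noisy_score_deriv_linear f_C3 sample') (dotvDl (c *: dF x u)).
rewrite (dotvDr (c *: dF' x u)) (dotvZl c) (dotvZr c).
exact: affine_combine.
Qed.

Let A1 : 1 <= A. Proof. exact: (sample_scale_ge1 sample). Qed.
Let A1' : 1 <= A'. Proof. exact: (sample_scale_ge1 sample'). Qed.
Let S_sqr : A + A' <= (A + A') ^+ 2.
Proof. by rewrite expr2 ler_peMl//; move: A1 A1'; lra. Qed.
Let b20 : 0 <= B ^+ 2. Proof. exact: sqr_ge0. Qed.

Let Xshift x v : X (x + v) = X x + (X (x + v) - X x).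
Proof. by rewrite [X x + _]addrC subrK. Qed.
Let Xshift' x v : X' (x + v) = X' x + (X' (x + v) - X' x).
Proof. by rewrite [X' x + _]addrC subrK. Qed.

Lemma kernel_draw_increment x v :
  `|k (X (x + v)) (X' (x + v)) - k (X x) (X' x)|
    <= B ^+ 2 * ((A + A') * enorm v).
Proof.
rewrite (Xshift x v) (Xshift' x v).
apply: le_trans (kernel_lipschitz k_psd dk kB _ _ _ _) _.
apply: (ler_wpM2l b20); rewrite mulrDl; apply: lerD.
  exact: (draw_increment sample x v).
exact: (draw_increment sample' x v).
Qed.

Let triangle_combine (k1 k2 p q r s w1 w2 w3 w4 : R) :
  `|p| <= w1 -> `|q| <= w2 -> `|k2 - k1 - (p + r + (q + s))| <= w4 ->
  w4 <= w3 -> w1 + w2 <= w3 -> `|k2 - k1 - (r + s)| <= 2 * w3.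
Proof. by rewrite !ler_norml; lra. Qed.

(** The kernel is expanded along the true increments of the draws, and its differential is then
    moved to the linearised ones. The Taylor error and the total defect of linearisation obey the
    same bound, hence the factor 2. *)
Lemma kernel_draw_remainder x v :
  `|k (X (x + v)) (X' (x + v)) - k (X x) (X' x) - kernel_deriv x v|
    <= 2 * B ^+ 2 * (A + A') ^+ 2 * enorm v ^+ 2.
Proof.
set h := X (x + v) - X x; set l := X' (x + v) - X' x.
have hT := kernel_taylor k_psd dk d11k d12k kB (X x) (X' x) h l.
rewrite -(Xshift x v) -(Xshift' x v) in hT.
have v0 := enorm_ge0 v; have v20 : 0 <= enorm v ^+ 2 by exact: exprn_ge0.
have hX : enorm h <= A * enorm v by exact: (draw_increment sample x v).
have lX : enorm l <= A' * enorm v by exact: (draw_increment sample' x v).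
have rX : enorm (h - dX x v) <= A * enorm v ^+ 2.
  exact: (draw_remainder sample x v).
have rX' : enorm (l - dX' x v) <= A' * enorm v ^+ 2.
  exact: (draw_remainder sample' x v).
have h1 : `|'D_(h - dX x v) (k ^~ (X' x)) (X x)| <= B ^+ 2 * (A * enorm v ^+ 2).
  apply: le_trans (kernel_D1_bound dk kB _ _ _) _; exact: (ler_wpM2l b20).
have h2 : `|'D_(l - dX' x v) (k ^~ (X x)) (X' x)| <= B ^+ 2 * (A' * enorm v ^+ 2).
  apply: le_trans (kernel_D1_bound dk kB _ _ _) _; exact: (ler_wpM2l b20).
have E1 : 'D_h (k ^~ (X' x)) (X x) =
    'D_(h - dX x v) (k ^~ (X' x)) (X x) + 'D_(dX x v) (k ^~ (X' x)) (X x).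
  have := derive_linear_fun 1 (h - dX x v) (dX x v) (dk (X' x) (X x)).
  by rewrite scale1r mul1r subrK.
have E2 : 'D_l (k ^~ (X x)) (X' x) =
    'D_(l - dX' x v) (k ^~ (X x)) (X' x) + 'D_(dX' x v) (k ^~ (X x)) (X' x).
  have := derive_linear_fun 1 (l - dX' x v) (dX' x v) (dk (X x) (X' x)).
  by rewrite scale1r mul1r subrK.
rewrite E1 E2 in hT.
have h3 : B ^+ 2 * (enorm h + enorm l) ^+ 2
    <= B ^+ 2 * ((A + A') ^+ 2 * enorm v ^+ 2).
  apply: (ler_wpM2l b20); rewrite -exprMn mulrDl; apply: lerXn2r.
  - by rewrite nnegrE addr_ge0 ?enorm_ge0.
  - by rewrite nnegrE addr_ge0// (le_trans _ hX, le_trans _ lX)// enorm_ge0.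
  - exact: lerD.
have h4 : B ^+ 2 * ((A + A') * enorm v ^+ 2)
    <= B ^+ 2 * ((A + A') ^+ 2 * enorm v ^+ 2).
  by apply: (ler_wpM2l b20); exact: (ler_wpM2r v20 S_sqr).
have h5 : B ^+ 2 * (A * enorm v ^+ 2) + B ^+ 2 * (A' * enorm v ^+ 2)
    <= B ^+ 2 * ((A + A') ^+ 2 * enorm v ^+ 2).
  by apply: le_trans h4; rewrite -mulrDr -mulrDl.
have -> : 2 * B ^+ 2 * (A + A') ^+ 2 * enorm v ^+ 2 =
  2 * (B ^+ 2 * ((A + A') ^+ 2 * enorm v ^+ 2)) by ring.
exact: (triangle_combine h1 h2 hT h3 h5).
Qed.

Lemma integrand_remainder x v :
  `|integrand (x + v) - integrand x - integrand_deriv x v|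
    <= B ^+ 2 * (A + A') ^+ 2
       * (2 * (enorm (F x) + enorm (F' x) + enorm (F' (x + v))) ^+ 2
          + 55 * (M ^+ 2 + Num.max 1 L ^+ 3)) * enorm v ^+ 2.
Proof.
exact: (product_remainder_bound (enorm_ge0 v) (ltW L0) (third_bound_ge0 fLM)
  A1 A1' (kernel_bound k_psd kB _ _) (kernel_draw_increment x v)
  (kernel_draw_remainder x v)
  (noisy_score_increment L0 f_C3 fLM sample x v)
  (noisy_score_increment L0 f_C3 fLM sample' x v)
  (noisy_score_remainder L0 f_C3 fLM sample x v)
  (noisy_score_remainder L0 f_C3 fLM sample' x v)).
Qed.

End Integrand.

(** * Measurability *)

Section Measurable_continuous.
Context {R : realType} (dT : measure_display) (T : measurableType dT).

Lemma measurable_row_box n (g : T -> 'rV[R]_n) (c : 'rV[rat]_n) (e : R) :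
  (forall i, measurable_fun setT (fun w => g w ord0 i)) ->
  measurable [set w | forall i, `|g w ord0 i - ratr (c ord0 i)| < e].
Proof.
move=> mg.
have -> : [set w | forall i, `|g w ord0 i - ratr (c ord0 i)| < e] =
   \bigcap_(i in [set: 'I_n]) ((fun w => g w ord0 i) @^-1`
     ball (ratr (c ord0 i) : R) e).
  apply/seteqP; split => w /= h i.
    by move=> _ /=; rewrite -ball_normE /= distrC; exact: h.
  by have := h i I; rewrite /= -ball_normE /= distrC.
apply: fin_bigcap_measurable => // i _.
by rewrite -[X in measurable X]setTI; apply: mg => //; apply: open_measurable; exact: ball_open.
Qed.

Lemma row_rat_approx n (x : 'rV[R]_n) (e : R) : 0 < e ->
  exists c : 'rV[rat]_n, forall i, `|x ord0 i - ratr (c ord0 i)| < e.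
Proof.
move=> e0.
have /choice[q qe] i : exists q : rat, `|x ord0 i - ratr q| < e.
  have [q] := @rat_in_itvoo R (x ord0 i - e) (x ord0 i + e) ltac:(lra).
  rewrite in_itv /= => /andP[q1 q2]; exists q.
  by rewrite ltr_norml; lra.
by exists (\row_i q i) => i; rewrite mxE.
Qed.

(** Measurability is given coordinate by coordinate, so the superlevel set is written as a countable
    union of preimages of rational boxes on which [k] exceeds [a]. Continuity puts every point of
    the set in such a box. *)
Lemma measurable_continuous2 n m (k : 'rV[R]_n -> 'rV[R]_m -> R)
    (g : T -> 'rV[R]_n) (h : T -> 'rV[R]_m) :
  continuous (fun xy : 'rV[R]_n * 'rV[R]_m => k xy.1 xy.2) ->
  (forall i, measurable_fun setT (fun w => g w ord0 i)) ->
  (forall i, measurable_fun setT (fun w => h w ord0 i)) ->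
  measurable_fun setT (fun w => k (g w) (h w)).
Proof.
move=> ck mg mh _.
apply: (measurability _ (RGenOInfty.measurableE R)) => // _ [_ [a ->] <-].
rewrite setTI.
pose box (c : 'rV[rat]_n) (c' : 'rV[rat]_m) (j : nat) :=
  [set w | forall i, `|g w ord0 i - ratr (c ord0 i)| < j.+1%:R^-1] `&`
  [set w | forall i, `|h w ord0 i - ratr (c' ord0 i)| < j.+1%:R^-1].
pose good (t : 'rV[rat]_n * 'rV[rat]_m * nat) := forall (x : 'rV[R]_n) (y : 'rV[R]_m),
  (forall i, `|x ord0 i - ratr (t.1.1 ord0 i)| < t.2.+1%:R^-1) ->
  (forall i, `|y ord0 i - ratr (t.1.2 ord0 i)| < t.2.+1%:R^-1) -> a < k x y.
have -> : (fun w => k (g w) (h w)) @^-1` `]a, +oo[ =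
    \bigcup_(t in [set: 'rV[rat]_n * 'rV[rat]_m * nat])
      (if `[< good t >] then box t.1.1 t.1.2 t.2 else set0).
  apply/seteqP; split => w /=; last first.
    move=> [t _]; case: asboolP => // gt [wg wh].
    by rewrite in_itv /= andbT; exact: gt.
  rewrite in_itv /= andbT => aw.
  have : nbhs (g w, h w) ((fun xy : 'rV[R]_n * 'rV[R]_m => k xy.1 xy.2)
      @^-1` [set r | a < r]).
    by apply: (ck (g w, h w)); apply: open_nbhs_nbhs; split => //; exact: open_gt.
  move=> /nbhs_ballP[e /= e0 eU].
  (* Half of the radius covers the distance from the point to the centre of the box, the other half
     that from the centre to any point of the box. *)
  have e2 : 0 < e / 2 by rewrite divr_gt0.
  have [j /= je] := filter_ex (near_infty_natSinv_lt (PosNum e2)).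
  have je' : j.+1%:R^-1 < e / 2 := je.
  have j0 : 0 < j.+1%:R^-1 :> R by rewrite invr_gt0.
  have [c gc] := row_rat_approx (g w) j0.
  have [c' hc'] := row_rat_approx (h w) j0.
  exists (c, c', j) => //; case: asboolP => [_|]; first by split.
  move=> ng; exfalso; apply: ng => x y /= xc yc'.
  apply: (eU (x, y)); split; split => // i l; rewrite ord1 -ball_normE /=.
    rewrite (le_lt_trans (ler_distD (ratr (c 0 l)) _ _))//.
    apply: (lt_trans (ltrD (gc l) _)); first by rewrite distrC; exact: xc.
    by move: (j.+1%:R^-1) je' => q; lra.
  rewrite (le_lt_trans (ler_distD (ratr (c' 0 l)) _ _))//.
  apply: (lt_trans (ltrD (hc' l) _)); first by rewrite distrC; exact: yc'.
  by move: (j.+1%:R^-1) je' => q; lra.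
apply: countable_bigcupT_measurable => [|t]; first exact: countableP.
case: asboolP => // _; apply: measurableI; exact: measurable_row_box.
Qed.

End Measurable_continuous.

(** * Independence *)

Section Independence.
Context {R : realType} (dO : measure_display) (Omega : measurableType dO).
Variable P : probability Omega R.

(** The joint law of [Z] and [Y] agrees with the product of the marginals on rectangles, hence
    everywhere, and Tonelli factors the integral. *)
Lemma ge0_expectation_indepM (Z Y : Omega -> R) :
  measurable_fun setT Z -> measurable_fun setT Y ->
  (forall w, 0 <= Z w) -> (forall w, 0 <= Y w) ->
  (forall A C : set R, measurable A -> measurable C ->
    P (Z @^-1` A `&` Y @^-1` C) = (P (Z @^-1` A) * P (Y @^-1` C))%E) ->
  (\int[P]_w (Z w * Y w)%:E = \int[P]_w (Z w)%:E * \int[P]_w (Y w)%:E)%E.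
Proof.
move=> mZ mY Z0 Y0 ind.
pose Zr : {RV P >-> R} := HB.pack_for {mfun Omega >-> R} Z
  (isMeasurableFun.Build _ _ _ _ Z mZ).
pose Yr : {RV P >-> R} := HB.pack_for {mfun Omega >-> R} Y
  (isMeasurableFun.Build _ _ _ _ Y mY).
have mZY : measurable_fun setT (fun w => (Z w, Y w)).
  exact: measurable_fun_pair.
pose ZY : {RV P >-> (R * R)%type} := HB.pack_for {mfun Omega >-> (R * R)%type}
  (fun w => (Z w, Y w)) (isMeasurableFun.Build _ _ _ _ (fun w => (Z w, Y w)) mZY).
(* The absolute values make the integrand nonnegative on the whole plane without changing it on the
   range of [(Z, Y)]. *)
pose F (xy : R * R) : \bar R := (`|xy.1|%:E * `|xy.2|%:E)%E.
have mF : measurable_fun setT F.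
  apply: emeasurable_funM; apply/measurable_EFinP/measurableT_comp => //.
have F0 xy : (0 <= F xy)%E by rewrite mule_ge0.
transitivity (\int[P]_w (F \o ZY) w)%E.
  by apply: eq_integral => w _; rewrite /F /= !ger0_norm.
rewrite -ge0_integral_distribution//.
transitivity (\int[(distribution P Zr \x distribution P Yr)%E]_xy F xy)%E.
  apply: eq_measure_integral => A mA _; apply/esym.
  by apply: product_measure_unique => // B C mB mC; exact: ind.
rewrite fubini_tonelli1//.
have mn : measurable_fun setT (fun y : R => `|y|%:E).
  by apply/measurable_EFinP; exact: normr_measurable.
transitivity (\int[distribution P Zr]_x
    (`|x|%:E * \int[distribution P Yr]_y `|y|%:E))%E.
  by apply: eq_integral => x _; rewrite /fubini_F /F /= ge0_integralZl.
rewrite ge0_integralZr//; last by apply: integral_ge0.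
rewrite !ge0_integral_distribution//.
by congr (_ * _)%E; apply: eq_integral => w _ /=; rewrite ger0_norm.
Qed.

Section Sigma_algebra_of_vector.
Variables (n : nat) (z : Omega -> 'rV[R]_n).
Hypothesis mz : forall j, measurable_fun setT (fun w => z w ord0 j).

Definition rectangles : set (set Omega) :=
  [set E | exists2 A : 'I_n -> set R, (forall j, measurable (A j)) &
     E = [set w | forall j, A j (z w ord0 j)]].

Lemma rectangles_setI : setI_closed rectangles.
Proof.
move=> _ _ [A mA ->] [C mC ->]; exists (fun j => A j `&` C j).
  by move=> j; exact: measurableI.
by apply/seteqP; split => w /= => [[h1 h2] j|h]; [split|split => j; case: (h j)].
Qed.

Lemma rectanglesT : rectangles setT.
Proof. by exists (fun _ => setT) => //; apply/seteqP; split. Qed.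

Lemma rectangles_measurable : rectangles `<=` measurable.
Proof.
move=> _ [A mA ->].
have -> : [set w | forall j, A j (z w ord0 j)] =
    \bigcap_(j in [set: 'I_n]) ((fun w => z w ord0 j) @^-1` A j).
  by apply/seteqP; split => w /= h j; [move=> _; exact: h|exact: h j I].
apply: fin_bigcap_measurable => // j _.
by rewrite -[X in measurable X]setTI; exact: mz.
Qed.

(** With [H] fixed, both sides are finite measures in [E]. They agree on a family stable under
    intersection, hence on the sigma-algebra it generates. *)
Lemma sigma_rectangles_indep (H : set Omega) : measurable H ->
  (forall E, rectangles E -> P (E `&` H) = (P E * P H)%E) ->
  forall E, <<s rectangles >> E -> P (E `&` H) = (P E * P H)%E.
Proof.
move=> mH ind E sE.
have PH0 : 0 <= fine (P H) by rewrite fine_ge0.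
have scaleE A : (P A * P H)%E = mscale (NngNum PH0) P A.
  by rewrite /mscale /= fineK ?fin_num_measure// muleC.
rewrite scaleE; apply: (@g_sigma_algebra_measure_unique _ _ _ rectangles rectangles_measurable
  (fun=> setT) (fun=> rectanglesT) _ (mrestr P mH) (mscale (NngNum PH0) P)) sE.
- by rewrite bigcup_const//; exists 0.
- exact: rectangles_setI.
- by move=> A rA; transitivity (P A * P H)%E; [exact: ind|exact: scaleE].
- move=> _; change (P (setT `&` H) < +oo)%E.
  by rewrite setTI ltey_eq fin_num_measure.
Qed.

Lemma coord_sigma_rectangles j :
  @measurable_fun _ _ (g_sigma_algebraType rectangles) R setT
    (fun w => z w ord0 j).
Proof.
move=> _ A mA; rewrite setTI; apply: sub_sigma_algebra.
exists (fun i => if i == j then A else setT).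
  by move=> i; case: ifP.
apply/seteqP; split => w /= => [h i|/(_ j)]; last by rewrite eqxx.
by case: eqP => // ->.
Qed.

(** An event about the norm of [z] involves all coordinates jointly and need not be a rectangle,
    which is why independence is first extended to the sigma-algebra. *)
Lemma enorm4_sigma_rectangles (A : set R) : measurable A ->
  <<s rectangles >> ((fun w => enorm (z w) ^+ 4) @^-1` A).
Proof.
move=> mA.
have mN : @measurable_fun _ _ (g_sigma_algebraType rectangles) R setT
    (fun w => enorm (z w) ^+ 4).
  have -> : (fun w => enorm (z w) ^+ 4) = (fun w => dotv (z w) (z w) ^+ 2).
    apply/funext => w; rewrite (exprM _ 2 2) sqr_sqrtr//.
    by apply: sumr_ge0 => i _; rewrite -expr2 sqr_ge0.
  apply: measurable_funX; apply: measurable_sum => i.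
  by apply: measurable_funM; exact: coord_sigma_rectangles.
by have := mN measurableT A mA; rewrite setTI.
Qed.

End Sigma_algebra_of_vector.
End Independence.

(** * Gaussian moments *)

Section Gaussian_moment.
Context {R : realType}.
Local Notation mu := (@lebesgue_measure R).

Lemma ge0_integral_normal_prob (m s : R) (f : _ -> \bar R) :
  measurable_fun setT f -> (forall x, 0 <= f x)%E ->
  (\int[normal_prob m s]_x f x = \int[mu]_x (f x * (normal_pdf m s x)%:E))%E.
Proof.
move=> mf f0; have dom := normal_prob_dominates m s.
rewrite -(Radon_Nikodym_SigmaFinite.change_of_variables dom)//.
have mpdf : measurable_fun setT (fun x => (normal_pdf m s x)%:E).
  by apply/measurable_EFinP; exact: measurable_normal_pdf.
have irn := Radon_Nikodym_SigmaFinite.f_integrable dom.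
have mrn := measurable_int _ irn.
apply: ae_eq_integral => //; try exact: emeasurable_funM.
apply: ae_eqe_mul2l; apply: integral_ae_eq => // E _ mE.
by rewrite -Radon_Nikodym_SigmaFinite.f_integral.
Qed.

(** Since -1/2 + 1/4 = -1/4, the product with the standard density is [sqrt 2] times the density of
    variance 2. *)
Lemma integral_normal_expR_sqr :
  (\int[@normal_prob R 0 1]_x (expR (x ^+ 2 / 4))%:E = (Num.sqrt 2)%:E)%E.
Proof.
have s20 : Num.sqrt 2 != 0 :> R by rewrite gt_eqF// sqrtr_gt0.
rewrite ge0_integral_normal_prob; last 2 first.
- apply/measurable_EFinP/measurableT_comp => //.
  by apply: measurable_funM => //; exact: measurable_funX.
- by move=> x; rewrite lee_fin expR_ge0.
transitivity (\int[mu]_x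
    ((Num.sqrt 2)%:E * (normal_pdf 0 (Num.sqrt 2) x)%:E))%E; last first.
  rewrite ge0_integralZl//=.
  - by rewrite integral_normal_pdf mule1.
  - by apply/measurable_EFinP; exact: measurable_normal_pdf.
  - by move=> x _; rewrite lee_fin normal_pdf_ge0.
apply: eq_integral => x _; rewrite -!EFinM; congr EFin.
rewrite normal_pdfE// normal_pdfE ?oner_neq0// /normal_peak /normal_fun.
rewrite sqr_sqrtr// expr1n subr0 mul1r.
have -> : Num.sqrt (2 * pi *+ 2) = Num.sqrt 2 * Num.sqrt (pi *+ 2) :> R.
  by rewrite -mulrnAr sqrtrM// ler0n.
have p0 : Num.sqrt (pi *+ 2) != 0 :> R.
  by rewrite gt_eqF// sqrtr_gt0 mulrn_wgt0// pi_gt0.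
rewrite invfM !mulrA mulfV// mul1r mulrAC -expRD mulrC; congr (_ * expR _).
by rewrite -(mulr_natr 2) -natrM; move: (x ^+ 2) => t; lra.
Qed.

Context (dO : measure_display) (Omega : measurableType dO).
Variables (P : probability Omega R) (X : Omega -> R).
Hypothesis mX : measurable_fun setT X.
Hypothesis lawX : forall A, measurable A -> P (X @^-1` A) = normal_prob 0 1 A.

Lemma expectation_expR_sqr :
  (\int[P]_w (expR (X w ^+ 2 / 4))%:E = (Num.sqrt 2)%:E)%E.
Proof.
rewrite -integral_normal_expR_sqr.
have mf : measurable_fun setT (fun x : R => (expR (x ^+ 2 / 4))%:E).
  apply/measurable_EFinP/measurableT_comp => //.
  by apply: measurable_funM => //; exact: measurable_funX.
pose Xr : {RV P >-> measurableTypeR R} :=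
  HB.pack_for {mfun Omega >-> measurableTypeR R} X
    (isMeasurableFun.Build _ _ Omega (measurableTypeR R) X mX).
transitivity (\int[distribution P Xr]_x (expR (x ^+ 2 / 4))%:E)%E.
  by rewrite ge0_integral_distribution// => x; rewrite lee_fin expR_ge0.
by apply: eq_measure_integral => A mA _; exact: lawX.
Qed.

End Gaussian_moment.

(** * Expectation of a smooth integrand *)

Section Mean_bound.
Context {R : realType} (d : measure_display) (T : measurableType d).
Variable mu : {measure set T -> \bar R}.
Implicit Types (f g : T -> R) (a b c : R).

(** Bundling measurability and sign with the bound lets moment estimates be added and scaled without
    side conditions. *)
Definition mean_le f c := [/\ measurable_fun setT f, forall x, 0 <= f x
  & (\int[mu]_x (f x)%:E <= c%:E)%E].

Lemma mean_leD f g a b :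
  mean_le f a -> mean_le g b -> mean_le (fun x => f x + g x) (a + b).
Proof.
move=> [mf f0 fa] [mg g0 gb]; split => [|x|].
- exact: measurable_funD.
- exact: addr_ge0.
under eq_integral do rewrite EFinD.
rewrite ge0_integralD//; first by rewrite EFinD leeD.
- by move=> x _; rewrite lee_fin.
- exact/measurable_EFinP.
- by move=> x _; rewrite lee_fin.
- exact/measurable_EFinP.
Qed.

Lemma mean_leZ f a c : 0 <= c ->
  mean_le f a -> mean_le (fun x => c * f x) (c * a).
Proof.
move=> c0 [mf f0 fa]; split => [|x|].
- exact: measurable_funM.
- exact: mulr_ge0.
under eq_integral do rewrite EFinM.
rewrite ge0_integralZl//; first by rewrite EFinM lee_wpmul2l.
- exact/measurable_EFinP.
- by move=> x _; rewrite lee_fin.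
Qed.

Lemma mean_le_weaken f a c : a <= c -> mean_le f a -> mean_le f c.
Proof. by move=> ac [mf f0 fa]; split => //; rewrite (le_trans fa)// lee_fin. Qed.

Lemma mean_le_sum (I : Type) (s : seq I) (f : I -> T -> R) (a : I -> R) :
  (forall i, mean_le (f i) (a i)) ->
  mean_le (fun x => \sum_(i <- s) f i x) (\sum_(i <- s) a i).
Proof.
move=> fa; elim: s => [|i s IH].
  rewrite big_nil; split => [|x|].
    by under eq_fun do rewrite big_nil; exact: measurable_cst.
    by rewrite big_nil.
  by under eq_integral do rewrite big_nil; rewrite integral0.
rewrite big_cons; under eq_fun do rewrite big_cons; exact: mean_leD.
Qed.

Lemma mean_le_integrable f c : mean_le f c -> mu.-integrable setT (EFin \o f).
Proof.
move=> [mf f0 fc]; apply/integrableP; split; first exact/measurable_EFinP.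
rewrite (eq_integral (fun x => (f x)%:E)).
  exact: le_lt_trans fc (ltry _).
by move=> x _; rewrite gee0_abs// lee_fin.
Qed.

Lemma mean_le_Rintegral f c : mean_le f c -> \int[mu]_x f x <= c.
Proof.
move=> fc; have /integrable_fin_num fin := mean_le_integrable fc.
have [_ _ h] := fc; rewrite /Rintegral -lee_fin fineK//; exact: fin.
Qed.

End Mean_bound.

Section Product_space.
Context {R : realType} (d : measure_display) (T : measurableType d).
Variable P : probability T R.

Lemma mean_le_cst (c : R) : 0 <= c -> mean_le P (fun=> c) c.
Proof.
move=> c0; split => //.
by rewrite integral_cst//= [X in (_ * X)%E]probability_setT mule1.
Qed.

Lemma mean_le_fst (f : T -> R) c : mean_le P f c ->
  mean_le (P \x P)%E (fun w => f w.1) c.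
Proof.
move=> [mf f0 fc]; have mf1 : measurable_fun setT (fun w : T * T => f w.1).
  exact: measurableT_comp.
split => //; rewrite fubini_tonelli1//; last 2 first.
- exact/measurable_EFinP.
- by move=> w; rewrite lee_fin.
rewrite /fubini_F /=; under eq_integral => x _.
  rewrite integral_cst// [X in (_ * X)%E]probability_setT mule1.
  over.
by [].
Qed.

Lemma mean_le_snd (f : T -> R) c : mean_le P f c ->
  mean_le (P \x P)%E (fun w => f w.2) c.
Proof.
move=> [mf f0 fc]; have mf2 : measurable_fun setT (fun w : T * T => f w.2).
  exact: measurableT_comp.
split => //; rewrite fubini_tonelli2//; last 2 first.
- exact/measurable_EFinP.
- by move=> w; rewrite lee_fin.
rewrite /fubini_G /=; under eq_integral => x _.
  rewrite integral_cst// [X in (_ * X)%E]probability_setT mule1.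
  over.
by [].
Qed.

End Product_space.

Section Smooth_expectation.
Context {R : realType} (d : measure_display) (T : measurableType d).
Variable mu : {measure set T -> \bar R}.
Variables (m : nat) (h : 'rV[R]_m -> T -> R) (dh : 'rV[R]_m -> T -> 'rV[R]_m -> R).
Variables (Lam : 'rV[R]_m -> 'rV[R]_m -> T -> R) (Q : R).
Hypothesis ih : forall x, mu.-integrable setT (EFin \o h x).
Hypothesis dh_lin : forall x w c u v,
  dh x w (c *: u + v) = c * dh x w u + dh x w v.
Hypothesis dh_quad : forall x v w,
  `|h (x + v) w - h x w - dh x w v| <= Lam x v w * enorm v ^+ 2.
Hypothesis dh_lim : forall x v w, exists c, forall t, 0 <= t <= 1 ->
  `|h (x + t *: v) w - h x w - dh x w (t *: v)| <= c * t ^+ 2.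
Hypothesis LamQ : forall x v, mean_le mu (Lam x v) Q.

Let dhZ x w c u : dh x w (c *: u) = c * dh x w u.
Proof.
have dh0 : dh x w 0 = 0.
  have := dh_lin x w 1 0 0; rewrite scale1r addr0 mul1r => E.
  by apply: (@addrI _ (dh x w 0)); rewrite addr0 -E.
by have := dh_lin x w c u 0; rewrite !addr0 dh0 addr0.
Qed.

Let measurable_h x : measurable_fun setT (h x).
Proof. by apply/measurable_EFinP; exact: measurable_int (ih x). Qed.

(** The linear part is a pointwise limit of measurable difference quotients. The bound [dh_lim]
    serves this limit: its constant is uniform in the step, whereas [Lam x (t *: v) w] may vary with
    [t]. *)
Let measurable_dh x v : measurable_fun setT (dh x ^~ v).
Proof.
apply: (@measurable_fun_cvg _ _ _ setT
  (fun n w => n.+1%:R * (h (x + n.+1%:R^-1 *: v) w - h x w))) => [n|w _].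
  by apply: measurable_funM => //; exact: measurable_funB.
have [c hc] := dh_lim x v w.
apply/cvgrPdist_le => e e0.
have c0 : 0 <= c.
  by have := hc 1; rewrite expr1n mulr1 lexx ler01 => /(_ isT); exact: le_trans.
have e1 : 0 < e / (c + 1) by rewrite divr_gt0// ltr_wpDl.
apply: filterS (near_infty_natSinv_lt (PosNum e1)) => n /= ne.
set q : R := n.+1%:R; have q0 : 0 < q by rewrite ltr0n.
have q1 : q^-1 <= 1 by rewrite invf_le1// ler1n.
have /hc : 0 <= q^-1 <= 1 by rewrite q1 invr_ge0 ltW.
rewrite dhZ => hq.
have -> : dh x w v - q * (h (x + q^-1 *: v) w - h x w)
  = - (q * (h (x + q^-1 *: v) w - h x w - q^-1 * dh x w v)).
  by field; rewrite gt_eqF.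
rewrite normrN normrM gtr0_norm//.
apply: (@le_trans _ _ (q * (c * q^-1 ^+ 2))); first by rewrite ler_pM2l.
have -> : q * (c * q^-1 ^+ 2) = c * q^-1 by field; rewrite gt_eqF.
apply: (@le_trans _ _ ((c + 1) * q^-1)).
  by rewrite ler_wpM2r ?invr_ge0 ?(ltW q0)// lerDl.
by rewrite mulrC -ler_pdivlMr ?ltr_wpDl//; exact: ltW ne.
Qed.

(** The linear part is the increment minus the remainder, hence dominated by [|h (x + v)| + |h x|]
    plus the integrable [enorm v ^+ 2 * Lam x v]. *)
Let integrable_dh x v : mu.-integrable setT (EFin \o (dh x ^~ v)).
Proof.
have iL : mu.-integrable setT (EFin \o (fun w => enorm v ^+ 2 * Lam x v w)).
  exact: mean_le_integrable (mean_leZ (sqr_ge0 _) (LamQ x v)).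
have := integrableD measurableT (integrableD measurableT
  (integrable_norm (ih (x + v))) (integrable_norm (ih x))) iL.
apply: le_integrable => //; first exact/measurable_EFinP.
move=> w _; rewrite /= lee_fin [leRHS]ger0_norm; last first.
  have [_ L0 _] := LamQ x v.
  by rewrite !addr_ge0// mulr_ge0// sqr_ge0.
have hp := dh_quad x v w; rewrite mulrC in hp.
rewrite -[X in Num.norm X <= _](subKr (h (x + v) w - h x w)).
exact: le_trans (ler_normB _ _) (lerD (ler_normB _ _) hp).
Qed.

Let ell x v := \int[mu]_w dh x w v.

Let ell_lin x c u v : ell x (c *: u + v) = c * ell x u + ell x v.
Proof.
rewrite /ell -RintegralZl// -RintegralD//.
  by apply: eq_Rintegral => w _; exact: dh_lin.
have := integrableZl measurableT c (integrable_dh x u).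
by apply: eq_integrable => // w _; rewrite /= EFinM.
Qed.

Let ell_dotv x v : ell x v = dotv (\row_i ell x (evec i)) v.
Proof.
have ell0 : ell x 0 = 0.
  have := ell_lin x 1 0 0; rewrite scale1r addr0 mul1r => E.
  by apply: (@addrI _ (ell x 0)); rewrite addr0 -E.
rewrite {1}(rowvec_sum v) /dotv.
elim/big_rec2: _ => // i y1 y2 _ E.
by rewrite ell_lin E mxE mulrC.
Qed.

Lemma smooth_expectation (f := fun x => \int[mu]_w h x w) : 0 <= Q ->
  (forall x, differentiable f x) /\
  (forall x y, enorm (grad f x - grad f y) <= 6 * Q * enorm (x - y)).
Proof.
move=> Q0.
have quad x v : `|f (x + v) - f x - dotv (\row_i ell x (evec i)) v|
    <= Q * enorm v ^+ 2.
  rewrite -ell_dotv /f /ell -RintegralB// -RintegralB//; last first.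
    by have := integrableB measurableT (ih (x + v)) (ih x); apply: eq_integrable.
  have iB : mu.-integrable setT (EFin \o
      (fun w => h (x + v) w - h x w - dh x w v)).
    have := integrableB measurableT
      (integrableB measurableT (ih (x + v)) (ih x)) (integrable_dh x v).
    by apply: eq_integrable.
  apply: le_trans (le_normr_Rintegral measurableT iB) _.
  have bound := mean_leZ (sqr_ge0 (enorm v)) (LamQ x v).
  rewrite mulrC; apply: le_trans (mean_le_Rintegral bound).
  apply: le_Rintegral => //.
  - exact: integrable_norm iB.
  - exact: mean_le_integrable bound.
  - by move=> w _; rewrite mulrC; exact: dh_quad.
split=> [x|x y]; first exact: quadratic_differentiable quad x.
by rewrite !(quadratic_grad quad); exact: quadratic_lipschitz quad x y Q0.
Qed.

End Smooth_expectation.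

(** * Size of the noise *)

Section Elementary_inequalities.
Context {R : realType}.
Implicit Types x y p q S a f W : R.

Lemma exprD4_le x y : (x + y) ^+ 4 <= 8 * (x ^+ 4 + y ^+ 4).
Proof.
have h1 : (x + y) ^+ 2 <= 2 * (x ^+ 2 + y ^+ 2).
  by have := sqr_ge0 (x - y); nra.
have h2 : (x ^+ 2 + y ^+ 2) ^+ 2 <= 2 * ((x ^+ 2) ^+ 2 + (y ^+ 2) ^+ 2).
  by have := sqr_ge0 (x ^+ 2 - y ^+ 2); nra.
have h3 : ((x + y) ^+ 2) ^+ 2 <= (2 * (x ^+ 2 + y ^+ 2)) ^+ 2.
  apply: lerXn2r h1; rewrite nnegrE; first exact: sqr_ge0.
  by rewrite mulr_ge0// addr_ge0 ?sqr_ge0.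
by rewrite !(exprM _ 2 2); apply: le_trans h3 _; rewrite exprMn; lra.
Qed.

Lemma exprD34_le x y p : (x + y + p) ^+ 4 <= 64 * (x ^+ 4 + y ^+ 4 + p ^+ 4).
Proof.
have h1 := exprD4_le (x + y) p; have h2 := exprD4_le x y.
have h3 : 0 <= p ^+ 4 by rewrite (exprM _ 2 2) sqr_ge0.
lra.
Qed.

(** If the means of [S^4] and [p^4] are of order [a^2] and [f^2], every term on the right has mean
    of order [a * (f + W)]. The 28 is 55/2 rounded up. *)
Lemma young_split S p a f W : 0 < a -> 0 < f -> 0 <= W ->
  S ^+ 2 * (2 * p ^+ 2 + 55 * W)
    <= (f + 28 * W) / a * S ^+ 4 + a / f * p ^+ 4 + 28 * W * a.
Proof.
move=> a0 f0 W0.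
have h1 : 2 * (S ^+ 2 * p ^+ 2) <= f / a * S ^+ 4 + a / f * p ^+ 4.
  have : 0 <= (f * S ^+ 2 - a * p ^+ 2) ^+ 2 / (a * f).
    by rewrite divr_ge0 ?sqr_ge0// mulr_ge0// ltW.
  have -> : (f * S ^+ 2 - a * p ^+ 2) ^+ 2 / (a * f) =
    f / a * S ^+ 4 + a / f * p ^+ 4 - 2 * (S ^+ 2 * p ^+ 2).
    by field; rewrite !gt_eqF.
  by rewrite subr_ge0.
have h2 : 2 * S ^+ 2 <= S ^+ 4 / a + a.
  have : 0 <= (S ^+ 2 - a) ^+ 2 / a by rewrite divr_ge0 ?sqr_ge0// ltW.
  have -> : (S ^+ 2 - a) ^+ 2 / a = S ^+ 4 / a + a - 2 * S ^+ 2.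
    by field; rewrite gt_eqF.
  by rewrite subr_ge0.
have h3 : 0 <= S ^+ 4 / a by rewrite divr_ge0 ?(ltW a0)// (exprM _ 2 2) sqr_ge0.
have h4 : W * (2 * S ^+ 2) <= W * (S ^+ 4 / a + a) by rewrite ler_wpM2l.
have h5 : 0 <= W * (S ^+ 4 / a) by exact: mulr_ge0.
have h6 : 0 <= W * a by rewrite mulr_ge0// ltW.
have -> : (f + 28 * W) / a * S ^+ 4 + a / f * p ^+ 4 + 28 * W * a =
  (f / a * S ^+ 4 + a / f * p ^+ 4) + 28 * (W * (S ^+ 4 / a)) + 28 * (W * a).
  by ring.
have -> : S ^+ 2 * (2 * p ^+ 2 + 55 * W) =
  2 * (S ^+ 2 * p ^+ 2) + 55 / 2 * (W * (2 * S ^+ 2)) by field.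
move: h1 h4 h5 h6; rewrite mulrDr; lra.
Qed.

End Elementary_inequalities.

Section Noise.
Context {R : realType}.
Variables (d : nat).
Hypothesis d0 : (0 < d)%N.
Implicit Types xi : 'rV[R]_d.

(** An average rather than a sum, so that its mean does not grow with [d]; in the bound on the
    largest coordinate, [d] then appears inside a logarithm only. *)
Definition noise_energy xi : R := d%:R^-1 * \sum_(i < d) expR (xi 0 i ^+ 2 / 4).

Let dR0 : 0 < d%:R :> R. Proof. by rewrite ltr0n. Qed.

Lemma noise_energy_coord xi i : expR (xi 0 i ^+ 2 / 4) <= d%:R * noise_energy xi.
Proof.
rewrite /noise_energy mulrA mulfV ?gt_eqF// mul1r (bigD1 i)//= lerDl.
by apply: sumr_ge0 => j _; exact: expR_ge0.
Qed.

Lemma noise_energy_gt0 xi : 0 < noise_energy xi.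
Proof.
rewrite mulr_gt0 ?invr_gt0// (lt_le_trans (expR_gt0 (xi 0 (Ordinal d0) ^+ 2 / 4)))//.
rewrite (bigD1 (Ordinal d0))//= lerDl.
by apply: sumr_ge0 => j _; exact: expR_ge0.
Qed.

(* The exponential moment controls the maximum: a maximum of [d] Gaussians is
   of order [sqrt (ln d)]. *)
Lemma noise_sup_bound xi : exists b : R, [/\ 0 <= b, forall i, `|xi 0 i| <= b &
  (1 + b) ^+ 4 <= 8 * (1 + 32 * ln d%:R ^+ 2 + 128 * noise_energy xi)].
Proof.
set Y := noise_energy xi; have Y0 : 0 < Y by exact: noise_energy_gt0.
set l : R := ln d%:R; have l0 : 0 <= l by rewrite ln_ge0// ler1n.
set r := Num.sqrt Y; have r0 : 0 < r by rewrite sqrtr_gt0.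
have rY : r ^+ 2 = Y by rewrite sqr_sqrtr// ltW.
(* A square root in place of the logarithm makes [b ^+ 4] linear in [Y]: it equals
   [16 * (l + 2 * r) ^+ 2], at most [32 * l ^+ 2 + 128 * Y]. *)
have lnY : ln Y <= 2 * r.
  by rewrite -rY lnXn// mulr2n; have := ln_sublinear r0; lra.
have b0 : 0 <= 4 * (l + 2 * r) by rewrite mulr_ge0// addr_ge0// mulr_ge0// ltW.
exists (Num.sqrt (4 * (l + 2 * r))); split; first exact: sqrtr_ge0.
  move=> i; rewrite -sqrtr_sqr ler_wsqrtr//.
  have h : xi 0 i ^+ 2 / 4 <= l + ln Y.
    have dp : d%:R \is @Num.pos R by rewrite posrE.
    have Yp : Y \is Num.pos by rewrite posrE.
    have dYp : d%:R * Y \is Num.pos by rewrite posrE mulr_gt0.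
    rewrite -(lnM dp Yp) -ler_expR (lnK dYp); exact: noise_energy_coord.
  by move: (xi 0 i ^+ 2) h lnY => t; lra.
have := exprD4_le 1 (Num.sqrt (4 * (l + 2 * r))).
rewrite (exprM (Num.sqrt _) 2 2) sqr_sqrtr// expr1n => /le_trans; apply.
rewrite ler_pM2l// -addrA lerD2l -rY.
by have := sqr_ge0 (l - 2 * r); nra.
Qed.

(** Cauchy-Schwarz against the all-ones vector gives [d] times the sum of the fourth powers, and the
    exponential of [t / 4] is at least [t ^+ 2 / 32]. *)
Lemma noise_norm_bound xi : enorm xi ^+ 4 <= 32 * d%:R ^+ 2 * noise_energy xi.
Proof.
rewrite (exprM _ 2 2) sqr_enorm.
pose u : 'rV[R]_d := \row_i xi 0 i ^+ 2; pose one : 'rV[R]_d := \row_i 1.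
have -> : dotv xi xi = dotv u one.
  by apply: eq_bigr => i _; rewrite !mxE mulr1 expr2.
apply: le_trans (dotv_sqr_le u one) _.
have -> : dotv one one = d%:R.
  rewrite /dotv (eq_bigr (fun=> 1)) ?sumr_const ?card_ord// => i _.
  by rewrite !mxE mulr1.
have -> : 32 * d%:R ^+ 2 * noise_energy xi =
    (32 * \sum_(i < d) expR (xi 0 i ^+ 2 / 4)) * d%:R.
  by rewrite /noise_energy; field; rewrite gt_eqF.
rewrite ler_pM2r// mulr_sumr; apply: ler_sum => i _; rewrite !mxE.
have := @expR_ge1Dxn R (xi 0 i ^+ 2 / 4) 1.
rewrite divr_ge0 ?sqr_ge0// => /(_ isT).
set t := xi 0 i ^+ 2; move: (expR (t / 4)) => e.
have -> : (t / 4) ^+ 2 / 2`!%:R = t * t / 32 by rewrite (_ : 2`! = 2)%N//; field.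
by move: (t * t) => y; lra.
Qed.

Lemma ediv_norm_bound xi (s : 'rV[R]_d) L : 0 < L ->
  (forall i, 1 / Num.sqrt L <= s 0 i) ->
  enorm (ediv xi s) <= Num.sqrt L * enorm xi.
Proof.
move=> L0 sL; have r0 : 0 < Num.sqrt L by rewrite sqrtr_gt0.
apply: enorm_le_coord => [|i]; first exact: ltW.
have s0 : 0 < s 0 i by apply: lt_le_trans (sL i); rewrite divr_gt0.
rewrite mxE normrM mulrC ler_wpM2r// gtr0_norm ?invr_gt0//.
by rewrite -[leRHS]invrK lef_pV2 ?posrE ?invr_gt0// -div1r.
Qed.

End Noise.

(** * Smoothness of the loss *)

Section Measurable_vectors.
Context {R : realType} (dT : measure_display) (T : measurableType dT).

Lemma measurable_continuous_row n (g : 'rV[R]_n -> R) (x : T -> 'rV[R]_n) :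
  continuous g -> (forall i, measurable_fun setT (fun w => x w ord0 i)) ->
  measurable_fun setT (fun w => g (x w)).
Proof.
move=> cg mx; apply: (@measurable_continuous2 _ _ _ _ _ (fun u _ => g u) x x) => //.
by move=> p; apply: continuous_comp; [exact: cvg_fst|exact: cg].
Qed.

Lemma measurable_dotv n (u v : T -> 'rV[R]_n) :
  (forall i, measurable_fun setT (fun w => u w ord0 i)) ->
  (forall i, measurable_fun setT (fun w => v w ord0 i)) ->
  measurable_fun setT (fun w => dotv (u w) (v w)).
Proof. by move=> mu mv; apply: measurable_sum => i; exact: measurable_funM. Qed.

Lemma measurable_enorm4 n (u : T -> 'rV[R]_n) :
  (forall i, measurable_fun setT (fun w => u w ord0 i)) ->
  measurable_fun setT (fun w => enorm (u w) ^+ 4).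
Proof.
move=> mu; have -> : (fun w => enorm (u w) ^+ 4) = (fun w => dotv (u w) (u w) ^+ 2).
  by apply/funext => w; rewrite (exprM _ 2 2) sqr_enorm.
by apply: measurable_funX; exact: measurable_dotv.
Qed.

Lemma measurable_inv_pos (f : T -> R) : measurable_fun setT f ->
  (forall w, 0 < f w) -> measurable_fun setT (fun w => (f w)^-1).
Proof.
move=> mf f0; have -> : (fun w => (f w)^-1) = (fun w => expR (- ln (f w))).
  by apply/funext => w; rewrite expRN lnK ?posrE.
apply: measurableT_comp => //; apply: measurableT_comp => //.
exact: measurableT_comp (@measurable_ln R) mf.
Qed.

End Measurable_vectors.

(** * Moments of the sample speed and of the noisy score, and their assembly *)

Section Main.
Context {R : realType}.
Variables (c1 c0 : R) (d dz m : nat) (dO : measure_display).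
Variables (Omega : measurableType dO) (P : probability Omega R).
Variables (z : Omega -> 'rV[R]_dz) (xi : Omega -> 'rV[R]_d).
Variables (f : 'rV[R]_d -> R) (k : 'rV[R]_d -> 'rV[R]_d -> R).
Variables (mu sigma : 'rV[R]_dz -> 'rV[R]_m -> 'rV[R]_d).
Variables (B L M G s : R) (xstar : 'rV[R]_d).
Hypotheses (c1_gt0 : 0 < c1) (c0_gt0 : 0 < c0).
Hypotheses (d_ge2 : (2 <= d)%N) (dz_ge1 : (1 <= dz)%N).
Hypothesis mz : forall j, measurable_fun setT (fun w => z w ord0 j).
Hypothesis mxi : forall i, measurable_fun setT (fun w => xi w ord0 i).
Hypothesis law_xi : forall i (A : set R), measurable A ->
  P ((fun w => xi w ord0 i) @^-1` A) = normal_prob 0 1 A.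
Hypothesis indep : forall (A : 'I_dz -> set R) (Bs : 'I_d -> set R),
  (forall j, measurable (A j)) -> (forall i, measurable (Bs i)) ->
  P ([set w | forall j, A j (z w ord0 j)] `&` [set w | forall i, Bs i (xi w ord0 i)])
  = (P [set w | forall j, A j (z w ord0 j)] *
     \prod_(i < d) P ((fun w => xi w ord0 i) @^-1` Bs i))%E.
Hypothesis mmu : forall phi i, measurable_fun setT (fun w => mu (z w) phi ord0 i).
Hypothesis msigma :
  forall phi i, measurable_fun setT (fun w => sigma (z w) phi ord0 i).
Hypothesis k_psd : cont_psd_kernel k.
Hypothesis dk : forall y x, differentiable (k ^~ y) x.
Hypothesis d11k : forall y u x, differentiable ('D_u (k ^~ y)) x.
Hypothesis d12k : forall x u y, differentiable (fun y' => 'D_u (k ^~ y') x) y.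
Hypothesis kB : forall x y (u v : 'rV[R]_d), enorm u <= 1 -> enorm v <= 1 ->
  [/\ k x y <= B ^+ 2,
      `|'D_u (k ^~ y) x| <= B ^+ 2,
      `|'D_v ('D_u (k ^~ y)) x| <= B ^+ 2
    & `|'D_v (fun y' => 'D_u (k ^~ y') x) y| <= B ^+ 2].
Hypothesis L0 : 0 < L.
Hypothesis f_C3 : C3 f.
Hypothesis fLM : forall x (u v w : 'rV[R]_d),
  enorm u <= 1 -> enorm v <= 1 -> enorm w <= 1 ->
  `|'D_u ('D_v f) x| <= L /\ `|'D_u ('D_v ('D_w f)) x| <= M.
Hypothesis G1 : 1 <= G.
Hypothesis dmu : forall zz phi, differentiable (mu zz) phi.
Hypothesis ddmu : forall zz v phi, differentiable ('D_v (mu zz)) phi.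
Hypothesis dsigma : forall zz phi, differentiable (sigma zz) phi.
Hypothesis ddsigma : forall zz v phi, differentiable ('D_v (sigma zz)) phi.
Hypothesis musigmaG : forall zz phi (v w : 'rV[R]_m), enorm v <= 1 -> enorm w <= 1 ->
  [/\ enorm ('D_v (mu zz) phi) <= G * (1 + enorm zz),
      enorm ('D_w ('D_v (mu zz)) phi) <= G * (1 + enorm zz),
      enorm ('D_v (sigma zz) phi) <= G * (1 + enorm zz)
    & enorm ('D_w ('D_v (sigma zz)) phi) <= G * (1 + enorm zz)].
Hypothesis sigmaL : forall zz phi i, 1 / Num.sqrt L <= sigma zz phi ord0 i.
Hypothesis z4 : (\int[P]_w ((enorm (z w)) ^+ 4)%:E <= (c1 * (dz%:R) ^+ 2)%:E)%E.
Hypothesis x4 : forall phi,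
  (\int[P]_w ((enorm (xsample mu sigma phi (z w) (xi w))) ^+ 4)%:E <= (s ^+ 4)%:E)%E.

Let Y w := noise_energy (xi w).
Let d_gt0 : (0 < d)%N. Proof. exact: ltn_trans d_ge2. Qed.

Let measurable_exp_noise i :
  measurable_fun setT (fun w => expR (xi w ord0 i ^+ 2 / 4)).
Proof.
by apply: measurableT_comp => //; apply: measurable_funM => //; exact: measurable_funX.
Qed.

Let exp_noise_mean i :
  mean_le P (fun w => expR (xi w ord0 i ^+ 2 / 4)) (Num.sqrt 2).
Proof.
split => [|w|]; [by []|exact: expR_ge0|].
by rewrite (expectation_expR_sqr (mxi i) (law_xi i)).
Qed.

Let d_gt0R : 0 < d%:R :> R. Proof. by rewrite ltr0n. Qed.

Let average_cst (x : R) : d%:R^-1 * \sum_(i < d) x = x.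
Proof. by rewrite sumr_const card_ord -[x *+ d]mulr_natl mulrA mulVf ?mul1r// gt_eqF. Qed.

Let Y_mean : mean_le P Y (Num.sqrt 2).
Proof.
rewrite -(average_cst (Num.sqrt 2)); apply: mean_leZ.
  by rewrite invr_ge0 ltW.
exact: mean_le_sum.
Qed.

Let indep_coord i (E C : set _) :
  <<s rectangles z >> E -> measurable C ->
  P (E `&` (fun w => xi w ord0 i) @^-1` C)
    = (P E * P ((fun w => xi w ord0 i) @^-1` C))%E.
Proof.
move=> sE mC; apply: (sigma_rectangles_indep mz) sE.
  by rewrite -[X in measurable X]setTI; exact: mxi.
(* The remaining noise coordinates are left unconstrained and contribute factors 1 to the
   product. *)
move=> _ [A mA ->]; have mBs l : measurable (if l == i then C else setT).
  by case: ifP.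
have := indep mA mBs.
have -> : [set w | forall l, (if l == i then C else setT) (xi w ord0 l)]
    = (fun w => xi w ord0 i) @^-1` C.
  apply/seteqP; split => w /= => [/(_ i)|h l]; first by rewrite eqxx.
  by case: eqP => // ->.
move=> ->; congr (_ * _)%E; rewrite (bigD1 i)//= eqxx big1 ?mule1// => l /negbTE ->.
by rewrite preimage_setT probability_setT.
Qed.

(** The noise energy averages over coordinates, so its product with [enorm (z w) ^+ 4] reduces to
    one Gaussian coordinate at a time. *)
Let z4_exp_noise_mean i :
  mean_le P (fun w => enorm (z w) ^+ 4 * expR (xi w ord0 i ^+ 2 / 4))
    (c1 * dz%:R ^+ 2 * Num.sqrt 2).
Proof.
have mz4 : measurable_fun setT (fun w => enorm (z w) ^+ 4).
  exact: measurable_enorm4.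
have z40 w : 0 <= enorm (z w) ^+ 4 by rewrite exprn_ge0// enorm_ge0.
split=> [|w|]; first exact: measurable_funM.
  by rewrite mulr_ge0// expR_ge0.
rewrite ge0_expectation_indepM//.
  rewrite (expectation_expR_sqr (mxi i) (law_xi i)) EFinM.
  by rewrite lee_wpmul2r// lee_fin sqrtr_ge0.
move=> A C mA mC.
have -> : (fun w => expR (xi w ord0 i ^+ 2 / 4)) @^-1` C =
  (fun w => xi w ord0 i) @^-1` ((fun x : R => expR (x ^+ 2 / 4)) @^-1` C) by [].
apply: indep_coord; first exact: enorm4_sigma_rectangles.
rewrite -[X in measurable X]setTI.
have : measurable_fun setT (fun x : R => expR (x ^+ 2 / 4)).
  by apply: measurableT_comp => //; apply: measurable_funM => //; exact: measurable_funX.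
exact.
Qed.

Let lnd : R := ln d%:R.
Let ln2 : R := ln 2.
Let ln2_gt0 : 0 < ln2. Proof. by rewrite ln_gt0// ltr1n. Qed.
Let ln2_le : ln2 <= lnd.
Proof. by rewrite ler_ln ?posrE// ler_nat. Qed.
Let lnd_gt0 : 0 < lnd. Proof. exact: lt_le_trans ln2_le. Qed.

(** A measurable majorant of the fourth power of the sample speed; 64 = 8 * 8 comes from expanding
    [(1 + enorm z)^4] and [(1 + b)^4]. *)
Let U w := 64 * G ^+ 4 * ((1 + enorm (z w) ^+ 4) * (1 + 32 * lnd ^+ 2 + 128 * Y w)).
(** Here 257 = 1 + 128 * 2, with 2 bounding the mean [sqrt 2] of the energy; dividing by [ln2 ^+ 2]
    absorbs it into [lnd ^+ 2]. *)
Let kU : R := 64 * (1 + c1) * (32 + 257 / ln2 ^+ 2).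
Let scaleA : R := G ^+ 2 * dz%:R * lnd.

Let dz_ge1R : 1 <= dz%:R :> R. Proof. by rewrite ler1n. Qed.
Let sqrt2_le2 : Num.sqrt 2 <= 2 :> R.
Proof.
rewrite -[leRHS]ger0_norm// -sqrtr_sqr ler_wsqrtr//.
by rewrite expr2 ler_peMl// ler1n.
Qed.

Let U_mean : mean_le P U (kU * scaleA ^+ 2).
Proof.
have G4 : 0 <= 64 * G ^+ 4 by rewrite mulr_ge0// exprn_ge0// (le_trans _ G1).
have zm : mean_le P (fun w => enorm (z w) ^+ 4) (c1 * dz%:R ^+ 2).
  by split => // [|w]; [exact: measurable_enorm4|rewrite exprn_ge0// enorm_ge0].
have zYm : mean_le P (fun w => enorm (z w) ^+ 4 * Y w)
    (c1 * dz%:R ^+ 2 * Num.sqrt 2).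
  have -> : (fun w => enorm (z w) ^+ 4 * Y w) = (fun w => d%:R^-1 *
      \sum_(i < d) (enorm (z w) ^+ 4 * expR (xi w ord0 i ^+ 2 / 4))).
    by apply/funext => w; rewrite /Y /noise_energy mulrCA -mulr_sumr.
  rewrite -(average_cst (c1 * _ * _)); apply: mean_leZ.
    by rewrite invr_ge0 ltW.
  exact: mean_le_sum.
have q0 : 0 <= 1 + 32 * lnd ^+ 2 by rewrite addr_ge0// mulr_ge0// sqr_ge0.
have -> : U = fun w => 64 * G ^+ 4 *
    ((1 + 32 * lnd ^+ 2) * (1 + enorm (z w) ^+ 4)
     + 128 * (Y w + enorm (z w) ^+ 4 * Y w)).
  by apply/funext => w; rewrite /U; ring.
have := mean_leZ G4 (mean_leD (mean_leZ q0 (mean_leD (mean_le_cst P ler01) zm))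
  (mean_leZ (ler0n R 128) (mean_leD Y_mean zYm))).
apply: mean_le_weaken.
have D1 : 1 + c1 * dz%:R ^+ 2 <= (1 + c1) * dz%:R ^+ 2.
  by rewrite mulrDl mul1r lerD2r; move: dz_ge1R; nra.
have D0 : 0 <= 1 + c1 * dz%:R ^+ 2.
  by rewrite addr_ge0// mulr_ge0 ?sqr_ge0// ltW.
have l1 : 257 <= 257 / ln2 ^+ 2 * lnd ^+ 2.
  rewrite mulrAC ler_pdivlMr; last exact: exprn_gt0.
  apply: ler_wpM2l; first exact: ler0n.
  by apply: lerXn2r ln2_le; rewrite nnegrE ltW.
have E : kU * scaleA ^+ 2 = 64 * G ^+ 4 *
    ((1 + c1) * dz%:R ^+ 2 * (32 * lnd ^+ 2 + 257 / ln2 ^+ 2 * lnd ^+ 2)).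
  by rewrite /kU /scaleA; ring.
rewrite E; apply: ler_wpM2l => //.
apply: (@le_trans _ _ ((1 + c1 * dz%:R ^+ 2) * (1 + 32 * lnd ^+ 2 + 256))).
  have : (1 + c1 * dz%:R ^+ 2) * Num.sqrt 2 <= (1 + c1 * dz%:R ^+ 2) * 2.
    exact: ler_wpM2l.
  move=> h.
  have -> : (1 + c1 * dz%:R ^+ 2) * (1 + 32 * lnd ^+ 2 + 256) =
    (1 + 32 * lnd ^+ 2) * (1 + c1 * dz%:R ^+ 2)
    + 128 * ((1 + c1 * dz%:R ^+ 2) * 2) by ring.
  rewrite lerD2l ler_pM2l//; apply: le_trans h.
  by rewrite mulrDl mul1r.
apply: (ler_pM D0 _ D1); first exact: addr_ge0 q0 (ler0n _ _).
by move: l1; lra.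
Qed.

Let X phi w := xsample mu sigma phi (z w) (xi w).
Let sp := grad f.
Let F phi w := noisy_score (mu (z w)) (sigma (z w)) (xi w) f phi.
Let C := Num.sqrt (c0 * (L ^+ 4 * (s ^+ 4 + enorm xstar ^+ 4)
                         + enorm (sp xstar) ^+ 4)).
Let scaleF : R := C + L * d%:R.
(** The inverse of [c0] undoes the factor [c0] inside [C ^+ 2]. *)
Let kV : R := 512 * (c0^-1 + 1).
(** A majorant of [enorm (F phi w) ^+ 4]: the score is compared with its value at [xstar], and the
    noise part is at most [sqrt L * enorm xi]. The constants are 8 * 64 and 8 * 32. *)
Let V phi w := 512 * (enorm (sp xstar) ^+ 4 + L ^+ 4 * enorm xstar ^+ 4
    + L ^+ 4 * enorm (X phi w) ^+ 4) + 256 * (L ^+ 2 * d%:R ^+ 2) * Y w.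

Let expr4_ge0 (x : R) : 0 <= x ^+ 4.
Proof. by rewrite (exprM _ 2 2) sqr_ge0. Qed.

Let measurable_X phi i : measurable_fun setT (fun w => X phi w ord0 i).
Proof.
rewrite /X /xsample; under eq_fun do rewrite !mxE.
by apply: measurable_funD => //; exact: measurable_funM.
Qed.

Let X_mean phi : mean_le P (fun w => enorm (X phi w) ^+ 4) (s ^+ 4).
Proof. by split => [|w|]; [exact: measurable_enorm4|exact: expr4_ge0|exact: x4]. Qed.

Let V_mean phi : mean_le P (V phi) (kV * scaleF ^+ 2).
Proof.
have b0 : 0 <= enorm (sp xstar) ^+ 4 + L ^+ 4 * enorm xstar ^+ 4.
  exact: addr_ge0 (expr4_ge0 _) (mulr_ge0 (expr4_ge0 _) (expr4_ge0 _)).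
have y0 : 0 <= 256 * (L ^+ 2 * d%:R ^+ 2).
  exact: mulr_ge0 (ler0n _ _) (mulr_ge0 (sqr_ge0 _) (sqr_ge0 _)).
have := mean_leD (mean_leZ (ler0n R 512) (mean_leD (mean_le_cst P b0)
  (mean_leZ (expr4_ge0 L) (X_mean phi)))) (mean_leZ y0 Y_mean).
apply: mean_le_weaken.
have t0 : 0 <= L ^+ 4 * (s ^+ 4 + enorm xstar ^+ 4) + enorm (sp xstar) ^+ 4.
  apply: addr_ge0 (expr4_ge0 _); apply: mulr_ge0 (expr4_ge0 _) _.
  exact: addr_ge0 (expr4_ge0 _) (expr4_ge0 _).
have C2 : C ^+ 2 = c0 * (L ^+ 4 * (s ^+ 4 + enorm xstar ^+ 4)
                         + enorm (sp xstar) ^+ 4).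
  by rewrite sqr_sqrtr// mulr_ge0// ltW.
have C0 : 0 <= C by exact: sqrtr_ge0.
have Ld0 : 0 <= L * d%:R by rewrite mulr_ge0// ltW.
have F2 : C ^+ 2 + (L * d%:R) ^+ 2 <= scaleF ^+ 2.
  by rewrite /scaleF sqrrD lerD2r lerDl mulrn_wge0// mulr_ge0.
have c00 : 0 <= c0^-1 by rewrite invr_ge0 ltW.
have -> : 512 * (enorm (sp xstar) ^+ 4 + L ^+ 4 * enorm xstar ^+ 4 + L ^+ 4 * s ^+ 4)
  = 512 * (c0^-1 * C ^+ 2).
  by rewrite C2; field; rewrite gt_eqF.
have h1 : 256 * (L ^+ 2 * d%:R ^+ 2) * Num.sqrt 2 <= 512 * (L * d%:R) ^+ 2.
  apply: le_trans (ler_wpM2l y0 sqrt2_le2) _.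
  by rewrite exprMn le_eqVlt; apply/orP; left; apply/eqP; ring.
apply: (@le_trans _ _ (kV * (C ^+ 2 + (L * d%:R) ^+ 2))); last first.
  apply: ler_wpM2l F2; apply: mulr_ge0; first exact: ler0n.
  exact: addr_ge0 c00 ler01.
apply: le_trans (lerD (lexx _) h1) _.
have p1 : 0 <= c0^-1 * (L * d%:R) ^+ 2 by rewrite mulr_ge0// sqr_ge0.
have p2 : 0 <= C ^+ 2 by exact: sqr_ge0.
by rewrite /kV; move: (C ^+ 2) ((L * d%:R) ^+ 2) p1 p2 => y t; lra.
Qed.

Let combine_score (p q r t u v : R) :
  p <= L * t -> L * t <= L * (u + v) -> r <= p + q -> r <= q + L * v + L * u.
Proof. by lra. Qed.

Let combine_noise (p q r t u : R) :
  p <= 8 * (q + r) -> q <= 64 * t -> r <= u -> p <= 512 * t + 8 * u.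
Proof. by lra. Qed.

Let F4_le phi w : enorm (F phi w) ^+ 4 <= V phi w.
Proof.
have F1 : enorm (F phi w) <= enorm (sp (X phi w))
    + Num.sqrt L * enorm (xi w).
  apply: le_trans (enormD _ _) _; apply: lerD; first exact: lexx.
  exact: ediv_norm_bound.
have F2 : enorm (sp (X phi w)) <=
    enorm (sp xstar) + L * enorm xstar + L * enorm (X phi w).
  have := grad_lipschitz f_C3 fLM xstar (X phi w - xstar).
  rewrite (addrC xstar) subrK => h.
  have h2 : L * enorm (X phi w - xstar) <= L * (enorm (X phi w) + enorm xstar).
    by apply: (ler_wpM2l (ltW L0)); exact: enormB.
  have h3 := enormD (sp (X phi w) - sp xstar) (sp xstar).
  rewrite subrK in h3; exact: (combine_score h h2 h3).
have e0 := enorm_ge0 (F phi w); have e1 := enorm_ge0 (sp (X phi w)).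
have e2 : 0 <= Num.sqrt L * enorm (xi w) by rewrite mulr_ge0 ?sqrtr_ge0 ?enorm_ge0.
have h1 : enorm (F phi w) ^+ 4
    <= 8 * (enorm (sp (X phi w)) ^+ 4 + (Num.sqrt L * enorm (xi w)) ^+ 4).
  by apply: le_trans (exprD4_le _ _); apply: lerXn2r F1; rewrite nnegrE ?addr_ge0.
have h2 : enorm (sp (X phi w)) ^+ 4 <= 64 * (enorm (sp xstar) ^+ 4
    + L ^+ 4 * enorm xstar ^+ 4 + L ^+ 4 * enorm (X phi w) ^+ 4).
  rewrite -!exprMn; apply: le_trans (exprD34_le _ _ _).
  by apply: lerXn2r F2; rewrite nnegrE// !addr_ge0 ?mulr_ge0 ?enorm_ge0// ltW.
have h3 : (Num.sqrt L * enorm (xi w)) ^+ 4 <= 32 * (L ^+ 2 * d%:R ^+ 2) * Y w.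
  rewrite exprMn (exprM (Num.sqrt L) 2 2) sqr_sqrtr ?(ltW L0)//.
  have -> : 32 * (L ^+ 2 * d%:R ^+ 2) * Y w = L ^+ 2 * (32 * d%:R ^+ 2 * Y w) by ring.
  by apply: ler_wpM2l; [exact: sqr_ge0|exact: noise_norm_bound].
rewrite /V.
have -> : 256 * (L ^+ 2 * d%:R ^+ 2) * Y w = 8 * (32 * (L ^+ 2 * d%:R ^+ 2) * Y w) by ring.
exact: (combine_noise h1 h2 h3).
Qed.

(** The noise bound [b] is chosen outcome by outcome and enters the means through [U] alone, so no
    measurable choice is required. *)
Let sample_exists w : exists a b,
  is_sample_bound (mu (z w)) (sigma (z w)) (xi w) L a b /\
  (a * (1 + b)) ^+ 4 <= U w.
Proof.
have [b [b0 xib b4]] := noise_sup_bound d_gt0 (xi w).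
have z0 := enorm_ge0 (z w).
exists (G * (1 + enorm (z w))), b; split.
  split.
  - by split; [exact: dmu|exact: ddmu|exact: dsigma|exact: ddsigma].
  - by move=> x v v' v1 v1'; exact: musigmaG.
  - by move=> x i; exact: sigmaL.
  - exact: xib.
  - by split=> //; move: G1; nra.
rewrite !exprMn /U.
have zb := exprD4_le 1 (enorm (z w)); rewrite expr1n in zb.
have -> : 64 * G ^+ 4 * ((1 + enorm (z w) ^+ 4) * (1 + 32 * lnd ^+ 2 + 128 * Y w))
  = G ^+ 4 * (8 * (1 + enorm (z w) ^+ 4))
    * (8 * (1 + 32 * lnd ^+ 2 + 128 * Y w)) by ring.
apply: ler_pM => //; first by exact: mulr_ge0 (expr4_ge0 _) (expr4_ge0 _).
by apply: ler_wpM2l.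
Qed.

Let h phi (w : Omega * Omega) := integrand k f (mu (z w.1)) (sigma (z w.1))
  (mu (z w.2)) (sigma (z w.2)) (xi w.1) (xi w.2) phi.
Let dh phi (w : Omega * Omega) v := integrand_deriv k f (mu (z w.1))
  (sigma (z w.1)) (mu (z w.2)) (sigma (z w.2)) (xi w.1) (xi w.2) phi v.
Let W : R := M ^+ 2 + Num.max 1 L ^+ 3.

Let W_ge0 : 0 <= W.
Proof.
rewrite addr_ge0 ?sqr_ge0// exprn_ge0// le_max ler01//.
Qed.

Let scaleA_gt0 : 0 < scaleA.
Proof.
apply: mulr_gt0 lnd_gt0; apply: mulr_gt0; last by rewrite ltr0n.
by apply: exprn_gt0; exact: lt_le_trans G1.
Qed.

Let scaleF_gt0 : 0 < scaleF.
Proof. by rewrite ltr_wpDl ?sqrtr_ge0// mulr_gt0. Qed.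

(** This is [young_split] at the scales [scaleA] and [scaleF], with 8 and 64 from the fourth powers
    of a sum of two speeds and of three scores. *)
Let Lam phi v (w : Omega * Omega) := B ^+ 2 *
  (8 * ((scaleF + 28 * W) / scaleA) * (U w.1 + U w.2)
   + (64 * (scaleA / scaleF) * (V phi w.1 + V phi w.2 + V (phi + v) w.2)
      + 28 * W * scaleA)).

Let kappa : R := 448 * kU + 192 * kV + 28.
Let Q : R := B ^+ 2 * (scaleA * (scaleF + W) * kappa).

Let kU_ge0 : 0 <= kU.
Proof.
apply: mulr_ge0.
  exact: mulr_ge0 (ler0n _ _) (addr_ge0 ler01 (ltW c1_gt0)).
exact: addr_ge0 (ler0n _ _) (divr_ge0 (ler0n _ _) (sqr_ge0 _)).
Qed.

Let kV_ge0 : 0 <= kV.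
Proof.
apply: mulr_ge0 (ler0n _ _) (addr_ge0 _ ler01).
by rewrite invr_ge0 ltW.
Qed.

Let Lam_mean phi v : mean_le (P \x P)%E (Lam phi v) Q.
Proof.
have a0 := ltW scaleA_gt0; have f0 := ltW scaleF_gt0.
have p1 : 0 <= 8 * ((scaleF + 28 * W) / scaleA).
  by rewrite mulr_ge0// divr_ge0// addr_ge0// mulr_ge0.
have p2 : 0 <= 64 * (scaleA / scaleF) by rewrite mulr_ge0// divr_ge0.
have p3 : 0 <= 28 * W * scaleA by rewrite mulr_ge0// mulr_ge0.
have := mean_leZ (sqr_ge0 B) (mean_leD
  (mean_leZ p1 (mean_leD (mean_le_fst U_mean) (mean_le_snd U_mean)))
  (mean_leD (mean_leZ p2 (mean_leD
     (mean_leD (mean_le_fst (V_mean phi)) (mean_le_snd (V_mean phi)))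
     (mean_le_snd (V_mean (phi + v)))))
   (mean_le_fst (mean_le_cst P p3)))).
apply: mean_le_weaken; apply: ler_wpM2l; first exact: sqr_ge0.
(* The weights cancel against the squared scales; in [kappa], 448 is 16 * 28 and 192 is 64 times the
   three scores. *)
rewrite [leLHS](_ : _ = scaleA * (16 * kU * (scaleF + 28 * W)
    + 192 * kV * scaleF + 28 * W)); last first.
  by field; rewrite !gt_eqF.
rewrite -[leRHS]mulrA; apply: (ler_wpM2l a0); rewrite /kappa.
have q1 := mulr_ge0 kU_ge0 f0; have q2 := mulr_ge0 kV_ge0 W_ge0.
have q3 := mulr_ge0 kU_ge0 W_ge0.
by move: (kU) (kV) (scaleF) (W) kU_ge0 kV_ge0 f0 W_ge0 q1 q2 q3 => p q r t; lra.
Qed.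

Let dh_lin phi w c u v : dh phi w (c *: u + v) = c * dh phi w u + dh phi w v.
Proof.
have [a [b [s1 _]]] := sample_exists w.1.
have [a' [b' [s2 _]]] := sample_exists w.2.
exact: (integrand_deriv_linear dk f_C3 s1 s2).
Qed.

Let dh_quad phi v w :
  `|h (phi + v) w - h phi w - dh phi w v| <= Lam phi v w * enorm v ^+ 2.
Proof.
have [a [b [s1 A4]]] := sample_exists w.1.
have [a' [b' [s2 A4']]] := sample_exists w.2.
apply: le_trans (integrand_remainder k_psd dk d11k d12k kB L0 f_C3 fLM s1 s2 phi v) _.
apply: ler_wpM2r; first exact: sqr_ge0.
rewrite -mulrA; apply: ler_wpM2l; first exact: sqr_ge0.
apply: le_trans (young_split _ _ scaleA_gt0 scaleF_gt0 W_ge0) _.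
rewrite [leRHS]addrA lerD2r.
have a0 := ltW scaleA_gt0; have f0 := ltW scaleF_gt0.
have p1 : 0 <= (scaleF + 28 * W) / scaleA.
  by rewrite divr_ge0// addr_ge0// mulr_ge0.
have p2 : 0 <= scaleA / scaleF by rewrite divr_ge0.
apply: lerD.
  rewrite -[leRHS]mulrA [leRHS]mulrCA; apply: (ler_wpM2l p1).
  apply: le_trans (exprD4_le _ _) _; rewrite ler_pM2l//; exact: lerD.
rewrite -[leRHS]mulrA [leRHS]mulrCA; apply: (ler_wpM2l p2).
apply: le_trans (exprD34_le _ _ _) _; rewrite ler_pM2l//.
by apply: lerD; [apply: lerD|]; exact: F4_le.
Qed.

(** The score at [phi + t *: v] differs from the one at [phi] by a Lipschitz increment, and [t <= 1]
    makes the bound independent of [t]. *)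
Let dh_lim phi v w : exists c, forall t, 0 <= t <= 1 ->
  `|h (phi + t *: v) w - h phi w - dh phi w (t *: v)| <= c * t ^+ 2.
Proof.
have [a [b [s1 A4]]] := sample_exists w.1.
have [a' [b' [s2 A4']]] := sample_exists w.2.
pose p := enorm (F phi w.1) + enorm (F phi w.2)
  + (enorm (F phi w.2) + 2 * L * (a' * (1 + b')) * enorm v).
exists (B ^+ 2 * (a * (1 + b) + a' * (1 + b')) ^+ 2 * (2 * p ^+ 2 + 55 * W)
  * enorm v ^+ 2) => t /andP[t0 t1].
have A1 := sample_scale_ge1 s2.
apply: le_trans (integrand_remainder k_psd dk d11k d12k kB L0 f_C3 fLM s1 s2
  phi (t *: v)) _.
rewrite enormZ ger0_norm// exprMn (mulrC (t ^+ 2)) mulrA.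
apply: ler_wpM2r; first exact: sqr_ge0.
apply: ler_wpM2r; first exact: sqr_ge0.
apply: ler_wpM2l; first exact: mulr_ge0 (sqr_ge0 _) (sqr_ge0 _).
rewrite lerD2r ler_pM2l//; apply: lerXn2r.
- by rewrite nnegrE !addr_ge0 ?enorm_ge0.
- rewrite nnegrE !addr_ge0 ?enorm_ge0// !mulr_ge0 ?enorm_ge0// ?(ltW L0)//.
    by have [_ _ _ _ [a1 _]] := s2; exact: le_trans a1.
  by have [_ _ _ _ [_ b0]] := s2; exact: addr_ge0.
apply: lerD; first exact: lexx.
have inc := noisy_score_increment L0 f_C3 fLM s2 phi (t *: v).
have tri := enormD (F (phi + t *: v) w.2 - F phi w.2) (F phi w.2).
rewrite subrK in tri; apply: le_trans tri _; rewrite addrC; apply: lerD => //.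
apply: le_trans inc _; rewrite enormZ ger0_norm//.
apply: ler_wpM2l; last by rewrite ler_piMl ?enorm_ge0.
apply: mulr_ge0 (mulr_ge0 (ler0n _ 2) (ltW L0)) _.
exact: le_trans ler01 A1.
Qed.

Let measurable_F phi i : measurable_fun setT (fun w => F phi w ord0 i).
Proof.
have -> : (fun w => F phi w ord0 i) = (fun w => 'D_(evec i) f (X phi w)
    + xi w ord0 i * (sigma (z w) phi ord0 i)^-1).
  by apply/funext => w; rewrite /F /noisy_score [LHS]mxE; congr (_ + _); rewrite mxE.
apply: measurable_funD.
  apply: (@measurable_continuous_row _ _ _ _ ('D_(evec i) f) (X phi)) => // x.
  by apply: differentiable_continuous; have [_ [dd _]] := f_C3; exact: dd.
apply: measurable_funM => //; apply: measurable_inv_pos => // w.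
by apply: lt_le_trans (sigmaL _ _ _); rewrite divr_gt0// sqrtr_gt0.
Qed.

Let measurable_h phi : measurable_fun setT (h phi).
Proof.
apply: measurable_funM.
  apply: (@measurable_continuous2 _ _ _ _ _ k (fun w : Omega * Omega => X phi w.1)
    (fun w => X phi w.2)) => [|i|i].
  - by have [] := k_psd.
  - exact: measurableT_comp (measurable_X phi i) measurable_fst.
  - exact: measurableT_comp (measurable_X phi i) measurable_snd.
apply: (@measurable_dotv _ _ _ _ (fun w : Omega * Omega => F phi w.1)
  (fun w => F phi w.2)) => i.
- exact: measurableT_comp (measurable_F phi i) measurable_fst.
- exact: measurableT_comp (measurable_F phi i) measurable_snd.
Qed.

Let mulr_le_expr4 (p q u v : R) :
  p ^+ 4 <= u -> q ^+ 4 <= v -> p * q <= u + v + 1.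
Proof.
rewrite !(exprM _ 2 2) => pu qv; have := sqr_ge0 (p - q).
have := sqr_ge0 (p ^+ 2 - 1); have := sqr_ge0 (q ^+ 2 - 1).
have := sqr_ge0 (p ^+ 2); have := sqr_ge0 (q ^+ 2); nra.
Qed.

Let integrable_h phi : (P \x P)%E.-integrable setT (EFin \o h phi).
Proof.
have := mean_le_integrable (mean_leZ (sqr_ge0 B) (mean_leD
  (mean_leD (mean_le_fst (V_mean phi)) (mean_le_snd (V_mean phi)))
  (mean_le_fst (mean_le_cst P ler01)))).
apply: le_integrable => //; first exact/measurable_EFinP.
move=> w _; rewrite /= lee_fin [leRHS]ger0_norm; last first.
  have [_ V0 _] := V_mean phi.
  exact: mulr_ge0 (sqr_ge0 _) (addr_ge0 (addr_ge0 (V0 _) (V0 _)) ler01).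
rewrite /h /integrand normrM; apply: ler_pM; [exact: normr_ge0|exact: normr_ge0|exact: (kernel_bound k_psd kB)|].
apply: le_trans (cauchy_schwarz _ _) _.
exact: (mulr_le_expr4 (F4_le phi w.1) (F4_le phi w.2)).
Qed.

Lemma ksd_loss_smooth (Lf := ksd_loss P z xi k sp mu sigma) :
  (forall phi, differentiable Lf phi) /\
  (forall phi1 phi2,
    enorm (grad Lf phi1 - grad Lf phi2) <= 6 * Q * enorm (phi1 - phi2)).
Proof.
have Q0 : 0 <= Q.
  apply: mulr_ge0 (sqr_ge0 _) _; apply: mulr_ge0.
    by apply: mulr_ge0; [exact: ltW|apply: addr_ge0 => //; exact: ltW].
  exact: addr_ge0 (addr_ge0 (mulr_ge0 (ler0n _ _) kU_ge0)
    (mulr_ge0 (ler0n _ _) kV_ge0)) (ler0n _ _).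
exact: (smooth_expectation integrable_h dh_lin dh_quad dh_lim Lam_mean Q0).
Qed.

End Main.

Set Strict Implicit.
Unset Implicit Arguments.

Theorem theorem2 (R : realType) (c1 c0 : R) (hc1 : 0 < c1) (hc0 : 0 < c0) :
  exists K : R,
  forall (d dz m : nat) (hd : (2 <= d)%N) (hdz : (1 <= dz)%N)
    (* probability space carrying the mixing variable z and the noise xi *)
    (dO : measure_display) (Omega : measurableType dO) (P : probability Omega R)
    (z : Omega -> 'rV[R]_dz) (xi : Omega -> 'rV[R]_d)
    (* target density, kernel, variational parameters *)
    (p : 'rV[R]_d -> R) (k : 'rV[R]_d -> 'rV[R]_d -> R)
    (mu sigma : 'rV[R]_dz -> 'rV[R]_m -> 'rV[R]_d)
    (B L M G s : R) (xstar : 'rV[R]_d),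
  (* z has law q(z); xi ~ N(0, I_d) independent of z *)
  (forall j, measurable_fun setT (fun w => z w ord0 j)) ->
  (forall i, measurable_fun setT (fun w => xi w ord0 i)) ->
  (forall i (A : set R), measurable A ->
      P ((fun w => xi w ord0 i) @^-1` A) = normal_prob 0 1 A) ->
  (forall (A : 'I_dz -> set R) (Bs : 'I_d -> set R),
      (forall j, measurable (A j)) -> (forall i, measurable (Bs i)) ->
      P ([set w | forall j, A j (z w ord0 j)] `&` [set w | forall i, Bs i (xi w ord0 i)])
      = (P [set w | forall j, A j (z w ord0 j)] *
         \prod_(i < d) P ((fun w => xi w ord0 i) @^-1` Bs i))%E) ->
  (* measurability of mu(z;phi), sigma(z;phi) as random variables *)
  (forall phi i, measurable_fun setT (fun w => mu (z w) phi ord0 i)) ->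
  (forall phi i, measurable_fun setT (fun w => sigma (z w) phi ord0 i)) ->
  (* p is a positive density (only its score matters) *)
  (forall x, 0 < p x) ->
  (* k is a continuous p.s.d. kernel, differentiable as needed for (A1) *)
  cont_psd_kernel k ->
  (forall y x, differentiable (k ^~ y) x) ->
  (forall y u x, differentiable ('D_u (k ^~ y)) x) ->
  (forall x u y, differentiable (fun y' => 'D_u (k ^~ y') x) y) ->
  (* (A1) *)
  (forall x y (u v : 'rV[R]_d), enorm u <= 1 -> enorm v <= 1 ->
     [/\ k x y <= B ^+ 2,
         `|'D_u (k ^~ y) x| <= B ^+ 2,
         `|'D_v ('D_u (k ^~ y)) x| <= B ^+ 2
       & `|'D_v (fun y' => 'D_u (k ^~ y') x) y| <= B ^+ 2]) ->
  (* (A2) *)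
  0 < L ->
  C3 (fun x => ln (p x)) ->
  (forall x (u v w : 'rV[R]_d), enorm u <= 1 -> enorm v <= 1 -> enorm w <= 1 ->
     `|'D_u ('D_v (fun y => ln (p y))) x| <= L /\
     `|'D_u ('D_v ('D_w (fun y => ln (p y)))) x| <= M) ->
  (* (A3) *)
  1 <= G ->
  (forall zz phi, differentiable (mu zz) phi) ->
  (forall zz v phi, differentiable ('D_v (mu zz)) phi) ->
  (forall zz phi, differentiable (sigma zz) phi) ->
  (forall zz v phi, differentiable ('D_v (sigma zz)) phi) ->
  (forall zz phi (v w : 'rV[R]_m), enorm v <= 1 -> enorm w <= 1 ->
     [/\ enorm ('D_v (mu zz) phi) <= G * (1 + enorm zz),
         enorm ('D_w ('D_v (mu zz)) phi) <= G * (1 + enorm zz),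
         enorm ('D_v (sigma zz) phi) <= G * (1 + enorm zz)
       & enorm ('D_w ('D_v (sigma zz)) phi) <= G * (1 + enorm zz)]) ->
  (forall zz phi i, 1 / Num.sqrt L <= sigma zz phi ord0 i) ->
  (* (A4) *)
  (\int[P]_w ((enorm (z w)) ^+ 4)%:E <= (c1 * (dz%:R) ^+ 2)%:E)%E ->
  (forall phi,
     (\int[P]_w ((enorm (xsample mu sigma phi (z w) (xi w))) ^+ 4)%:E
        <= (s ^+ 4)%:E)%E) ->
  (* conclusion: L(phi) is L_phi-smooth *)
  let sp := grad (fun x => ln (p x)) in
  let Lf := ksd_loss P z xi k sp mu sigma in
  let C := Num.sqrt (c0 * (L ^+ 4 * (s ^+ 4 + enorm xstar ^+ 4)
                           + enorm (sp xstar) ^+ 4)) in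
  let Lphi := K * B ^+ 2 * G ^+ 2 * dz%:R * ln (d%:R : R) *
              ((Num.max 1 L) ^+ 3 + L * d%:R + M ^+ 2 + C) in
  (forall phi, differentiable Lf phi) /\
  (forall phi1 phi2, enorm (grad Lf phi1 - grad Lf phi2) <= Lphi * enorm (phi1 - phi2)).
Proof.
pose kU : R := 64 * (1 + c1) * (32 + 257 / ln 2 ^+ 2).
pose kV : R := 512 * (c0^-1 + 1).
(* The 6 is lost in passing from the remainder to the gradient; the other factor is [kappa], which
   depends on [c1] and [c0] only. *)
exists (6 * (448 * kU + 192 * kV + 28)).
move=> d dz m d2 dz1 dO Omega P z xi p k mu sigma B L M G s xstar.
move=> mz mxi law ind mmu msg _ kpsd dk d11 d12 kB L0 fC3 fLM G1 dmu ddmu dsg ddsg.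
move=> bnd sgL z4 x4 sp Lf C Lphi.
have [dL lipL] := ksd_loss_smooth xstar hc1 hc0 d2 dz1 mz mxi law ind mmu msg kpsd
  dk d11 d12 kB L0 fC3 fLM G1 dmu ddmu dsg ddsg bnd sgL z4 x4.
split=> [//|phi1 phi2]; apply: le_trans (lipL phi1 phi2) _.
rewrite le_eqVlt; apply/orP; left; apply/eqP; congr (_ * _).
by rewrite /Lphi /C /kU /kV; ring.
Qed.
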